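(* Let $(M,g_{ab})$ be a pseudo-Riemannian manifold of dimension $n\ge 3$ with Cotton tensor $C_{abc}$, and let $Y_{ab}$ be a conformal Killing--Yano 2-form on $(M,g_{ab})$. Define the CKY--Cotton current $\mathcal{J}_a:=C_{bca}Y^{bc}$. Then $\mathcal{J}_a$ is conserved: $\nabla^a\mathcal{J}_a=0$.
   Context: $\nabla$ is the Levi-Civita connection of $g$; indices are raised and lowered with $g$; square brackets denote antisymmetrization with total weight one, so $2g_{c[a}\xi_{b]}=g_{ca}\xi_b-g_{cb}\xi_a$. A conformal Killing--Yano (CKY) 2-form is a smooth 2-form $Y_{ab}$ satisfying $\nabla_cY_{ab}=2g_{c[a}\xi_{b]}+z_{abc}$, where $z_{abc}=z_{[abc]}$ is totally antisymmetric (it is $dY$ up to normalization) and $\xi_a=\frac{1}{n-1}\nabla^bY_{ba}$. The Cotton tensor is $C_{abc}=\nabla_cA_{ab}-\nabla_bA_{ac}$, where $A_{ab}=R_{ab}-\frac{R}{2(n-1)}g_{ab}$ is the Schouten tensor (up to a normalization constant). It is antisymmetric in its last two indices. *)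

(* Defs.v *)
From HB Require Import structures.
From mathcomp Require Import all_boot all_order all_algebra.
From mathcomp Require Import ring.
From mathcomp Require Import all_classical all_reals all_analysis.
Set Implicit Arguments.
Unset Strict Implicit.
Unset Printing Implicit Defensive.
Import Order.TTheory GRing.Theory Num.Theory.
Import numFieldNormedType.Exports.
Local Open Scope classical_set_scope.
Local Open Scope ring_scope.

(* A tensor field is given by its components in every chart of an atlas,
   subject to the tensor transformation law.  Component functions are total
   on R^n; they are only meaningful on the (open) image of the chart, and
   every condition below is imposed on that image only. *)

Section Smooth.
Variables (R : realType) (n : nat).
Implicit Types (U : set 'rV[R]_n) (f : 'rV[R]_n -> R).

Definition partial (i : 'I_n) f : 'rV[R]_n -> R := 'D_(delta_mx 0 i) f.

(* U is meant to be open. *)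
Fixpoint Ck (k : nat) U f : Prop :=
  (forall x, U x -> {for x, continuous f}) /\
  (if k is k'.+1 then
     forall i : 'I_n,
       (forall x, U x -> derivable f x (delta_mx 0 i)) /\ Ck k' U (partial i f)
   else True).

Definition smooth U f : Prop := forall k, Ck k U f.

End Smooth.

Section Manifold.
Variables (R : realType) (n : nat).

(* A homeomorphism [coord] from the open set [cdom] of M onto an open set of
   R^n, with inverse [param]. *)
Record chart (M : topologicalType) := Chart {
  cdom : set M;
  coord : M -> 'rV[R]_n;
  param : 'rV[R]_n -> M;
  cdom_open : open cdom;
  cimage_open : open (coord @` cdom);
  coordK : forall p, cdom p -> param (coord p) = p;
  coord_continuous : {within cdom, continuous coord};
  param_continuous : {within coord @` cdom, continuous param}
}.

Definition cimage (M : topologicalType) (e : chart M) : set 'rV[R]_n :=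
  coord e @` cdom e.

Definition overlap (M : topologicalType) (e e' : chart M) : set 'rV[R]_n :=
  coord e @` (cdom e `&` cdom e').

Definition transition (M : topologicalType) (e e' : chart M) :
  'rV[R]_n -> 'rV[R]_n := fun x => coord e' (param e x).

Record manifold := Manifold {
  carrier :> topologicalType;
  atlas : set (chart carrier);
  manifold_hausdorff : hausdorff_space carrier;
  manifold_second_countable : @second_countable carrier;
  atlas_cover : forall p : carrier, exists2 e, atlas e & cdom e p;
  atlas_smooth : forall e e', atlas e -> atlas e' ->
    forall c : 'I_n,
      smooth (overlap e e') (fun x => transition e e' x 0 c)
}.

Definition field2 (M : manifold) := chart M -> 'rV[R]_n -> 'M[R]_n.
Definition field3 (M : manifold) :=
  chart M -> 'rV[R]_n -> 'I_n -> 'I_n -> 'I_n -> R.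

(* ['J h x] has entries ('J h x) a c = d h^c / d x^a, so the first law reads
   T_ab = (d x'^c / d x^a) (d x'^d / d x^b) T'_cd. *)
Definition is_tensor2 (M : manifold) (T : field2 M) : Prop :=
  (forall e, atlas e -> forall a b, smooth (cimage e) (fun x => T e x a b)) /\
  (forall e e', atlas e -> atlas e' -> forall x, overlap e e' x ->
     T e x = 'J (transition e e') x *m T e' (transition e e' x)
               *m ('J (transition e e') x)^T).

Definition is_tensor3 (M : manifold) (T : field3 M) : Prop :=
  (forall e, atlas e ->
     forall a b c, smooth (cimage e) (fun x => T e x a b c)) /\
  (forall e e', atlas e -> atlas e' -> forall x, overlap e e' x ->
     forall a b c, T e x a b c =
       \sum_(a' < n) \sum_(b' < n) \sum_(c' < n)
         'J (transition e e') x a a' * 'J (transition e e') x b b' *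
         'J (transition e e') x c c' * T e' (transition e e' x) a' b' c').

Definition is_metric (M : manifold) (g : field2 M) : Prop :=
  is_tensor2 g /\
  (forall e, atlas e -> forall x, cimage e x ->
     (g e x)^T = g e x /\ g e x \in unitmx).

Definition is_2form (M : manifold) (Y : field2 M) : Prop :=
  is_tensor2 Y /\
  (forall e, atlas e -> forall x, cimage e x -> (Y e x)^T = - Y e x).

Definition is_3form (M : manifold) (z : field3 M) : Prop :=
  is_tensor3 z /\
  (forall e, atlas e -> forall x, cimage e x -> forall a b c,
     z e x b a c = - z e x a b c /\ z e x a c b = - z e x a b c).

End Manifold.

(* Local formulas in a chart; G is the matrix of components of the metric. *)
Section Local.
Variables (R : realType) (n : nat) (G : 'rV[R]_n -> 'M[R]_n).
Implicit Types (x : 'rV[R]_n) (i j k a b c d e : 'I_n).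
Implicit Types (S T : 'rV[R]_n -> 'M[R]_n) (w : 'rV[R]_n -> 'rV[R]_n).

Definition ginv x : 'M[R]_n := invmx (G x).

(* Gamma^k_{ij}: the coefficients of the Levi-Civita connection, see
   [christoffel_torsion_free] and [nabla2_metric] below. *)
Definition christoffel x k i j : R :=
  2^-1 * \sum_(d < n) ginv x k d *
    (partial i (fun y => G y j d) x + partial j (fun y => G y i d) x
     - partial d (fun y => G y i j) x).

(* nabla_c w_a *)
Definition nabla1 w x c a : R :=
  partial c (fun y => w y 0 a) x - \sum_(d < n) christoffel x d c a * w x 0 d.

(* nabla_c T_{ab} *)
Definition nabla2 T x c a b : R :=
  partial c (fun y => T y a b) x
  - \sum_(d < n) christoffel x d c a * T x d b
  - \sum_(d < n) christoffel x d c b * T x a d.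

(* R^c_{dab}, with [nabla_a, nabla_b] V^c = R^c_{dab} V^d. *)
Definition riemann x c d a b : R :=
  partial a (fun y => christoffel y c b d) x
  - partial b (fun y => christoffel y c a d) x
  + \sum_(e < n) (christoffel x c a e * christoffel x e b d
                  - christoffel x c b e * christoffel x e a d).

Definition ricci x : 'M[R]_n :=
  \matrix_(a, b) \sum_(c < n) riemann x c a c b.

Definition scalar_curvature x : R :=
  \sum_(a < n) \sum_(b < n) ginv x a b * ricci x a b.

Definition schouten x : 'M[R]_n :=
  ricci x - (scalar_curvature x / (2 * (n%:R - 1))) *: G x.

(* C_{abc} = nabla_c A_{ab} - nabla_b A_{ac} *)
Definition cotton x a b c : R :=
  nabla2 schouten x c a b - nabla2 schouten x b a c.

(* T^{ab} = g^{ac} g^{bd} T_{cd} *)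
Definition raise2 T x : 'M[R]_n := ginv x *m T x *m (ginv x)^T.

(* nabla^a w_a *)
Definition divergence w x : R :=
  \sum_(a < n) \sum_(b < n) ginv x a b * nabla1 w x b a.

(* xi_a = (n - 1)^-1 nabla^b Y_{ba} *)
Definition cky_xi T x a : R :=
  (n%:R - 1)^-1 * \sum_(b < n) \sum_(c < n) ginv x b c * nabla2 T x c b a.

(* J_a = C_{bca} Y^{bc} *)
Definition cky_cotton_current T x : 'rV[R]_n :=
  \row_a \sum_(b < n) \sum_(c < n) cotton x b c a * raise2 T x b c.

Lemma partial_sym (U : set 'rV[R]_n) : open U ->
  (forall y, U y -> (G y)^T = G y) -> forall x, U x -> forall c a b,
  partial c (fun y => G y a b) x = partial c (fun y => G y b a) x.
Proof.
move=> Uo Gsym x Ux c a b; apply: near_eq_derive.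
have := open_nbhs_nbhs (conj Uo Ux); apply: filterS => y Uy.
by rewrite -[in LHS](Gsym y Uy) mxE.
Qed.

Lemma christoffel_torsion_free (U : set 'rV[R]_n) : open U ->
  (forall y, U y -> (G y)^T = G y) -> forall x, U x -> forall k i j,
  christoffel x k i j = christoffel x k j i.
Proof.
move=> Uo Gsym x Ux k i j; rewrite /christoffel; congr (_ * _).
apply: eq_bigr => d _; rewrite (partial_sym Uo Gsym Ux d i j).
by rewrite [partial i _ x + _]addrC.
Qed.

Lemma nabla2_metric (U : set 'rV[R]_n) : open U ->
  (forall y, U y -> (G y)^T = G y /\ G y \in unitmx) -> forall x, U x ->
  forall c a b, nabla2 G x c a b = 0.
Proof.
move=> Uo HG x Ux c a b.
have Gsym y : U y -> (G y)^T = G y by move=> /HG[].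
have [Gx Gu] := HG x Ux.
have ginv_sym i j : ginv x i j = ginv x j i.
  by rewrite /ginv -[in LHS]Gx -trmx_inv mxE.
have lower i j m : \sum_(d < n) christoffel x d i j * G x d m =
    2^-1 * (partial i (fun y => G y j m) x + partial j (fun y => G y i m) x
            - partial m (fun y => G y i j) x).
  rewrite /christoffel.
  set F := fun l : 'I_n => partial i (fun y => G y j l) x
    + partial j (fun y => G y i l) x - partial l (fun y => G y i j) x.
  rewrite -[RHS]/(2^-1 * F m).
  under eq_bigr do rewrite -mulrA.
  rewrite -mulr_sumr; congr (_ * _).
  under eq_bigr do rewrite mulr_suml.
  rewrite exchange_big /= (bigD1 m) //= [X in _ + X]big1 ?addr0.
    rewrite -[RHS]mul1r.
    have <- : (ginv x *m G x) m m = 1 by rewrite mulVmx // mxE eqxx.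
    rewrite mxE mulr_suml; apply: eq_bigr => d _.
    by rewrite (ginv_sym d m) mulrAC.
  move=> l lm; under eq_bigr do rewrite mulrAC.
  rewrite -mulr_suml -[X in X * _](_ : (ginv x *m G x) l m = _).
    by rewrite mulVmx // mxE (negbTE lm) mul0r.
  by rewrite mxE; apply: eq_bigr => d _; rewrite (ginv_sym d l).
rewrite /nabla2 lower.
under [X in _ - _ - X]eq_bigr => d _.
  rewrite -[G x a d](_ : G x d a = _); last by rewrite -[in LHS]Gx mxE.
  over.
rewrite lower (partial_sym Uo Gsym Ux c b a).
by field.
Qed.

End Local.

(* nabla_c Y_ab = 2 g_{c[a} xi_{b]} + z_abc, for some 3-form z. *)
Definition is_CKY (R : realType) (n : nat) (M : manifold R n)
    (g Y : field2 M) : Prop :=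
  is_2form Y /\
  exists2 z : field3 M, is_3form z &
    forall e, atlas e -> forall x, cimage e x -> forall a b c,
      nabla2 (g e) (Y e) x c a b =
        g e x c a * cky_xi (g e) (Y e) x b - g e x c b * cky_xi (g e) (Y e) x a
        + z e x a b c.

(* Main.v *)
Require Import Defs.
From HB Require Import structures.
From mathcomp Require Import all_boot all_order all_algebra.
From mathcomp Require Import ring.
From mathcomp Require Import all_classical all_reals all_analysis.
Import Order.TTheory GRing.Theory Num.Theory.
Import numFieldNormedType.Exports.
Local Open Scope classical_set_scope.
Local Open Scope ring_scope.
Set Implicit Arguments.
Unset Strict Implicit.
Unset Printing Implicit Defensive.

(* By the product rule the divergence of J is
     (nabla^a C_{bca}) Y^{bc} + C_{bca} nabla^a Y^{bc}.
   With A the Schouten tensor, nabla^a C_{bca} equals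
   nabla^a nabla_a A_{bc} - nabla^a nabla_c A_{ba}.  The first term is symmetric
   in b, c.  In the second, commuting the derivatives leaves
   nabla_c nabla^a A_{ba}, which is the Hessian of tr A by the contracted
   Bianchi identity, and curvature terms that the symmetries of the Riemann
   tensor make symmetric.  Hence the contraction with Y^{bc} vanishes.  The
   other term vanishes by the CKY equation, because C is trace-free and its
   totally antisymmetric part is zero.

   The identities are purely algebraic in the ring of smooth functions on a
   chart with its commuting partial derivatives. *)

(** Component functions are meaningful only on the chart image [U], so differentiating an identity
    between them would call each time for a neighbourhood argument and differentiability conditions.
    In a ring whose equality is agreement on [U], partial derivatives are total operations and these
    conditions are settled once. Tensors with more than two indices become families of matrices:
    [cov] differentiates the two matrix indices, and the remaining indices are labels whose
    connection terms are added separately, as in [cov_lcurv] and [cov2_sch]. The abstract ring has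
    no division, so 1/2 and 1/(2(n-1)) enter as elements [half] and [kap]. The value of [kap] is the
    one for which div A = d(tr A); both the Hessian and the trace-freeness of C rest on that
    equation. Of the two curvature terms, the Riemann one is symmetric by pair symmetry, the Ricci
    one because A differs from Ricci by a multiple of g. *)

(* Instances of [mxE] for one constructor each: [mxE] itself would also unfold
   defined matrices such as [lcurv] and [cot]. *)
Lemma mxaddE (A : pzRingType) m n (M N : 'M[A]_(m, n)) i j :
  (M + N) i j = M i j + N i j.
Proof. by rewrite mxE. Qed.

Lemma mxoppE (A : pzRingType) m n (M : 'M[A]_(m, n)) i j :
  (- M) i j = - M i j.
Proof. by rewrite mxE. Qed.

Lemma mxzeroE (A : pzRingType) m n i j : (0 : 'M[A]_(m, n)) i j = 0.
Proof. by rewrite mxE. Qed.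

Lemma mxfunE (A : pzRingType) m n (F : 'I_m -> 'I_n -> A) i j :
  (\matrix_(a, b) F a b) i j = F i j.
Proof. by rewrite mxE. Qed.

Lemma mxtrE (A : pzRingType) m n (M : 'M[A]_(m, n)) i j : M^T i j = M j i.
Proof. by rewrite mxE. Qed.

Lemma mxsubE (A : pzRingType) m n (M N : 'M[A]_(m, n)) i j :
  (M - N) i j = M i j - N i j.
Proof. by rewrite !mxE. Qed.

Lemma mxscaleE (A : pzRingType) m n (c : A) (M : 'M[A]_(m, n)) i j :
  (c *: M) i j = c * M i j.
Proof. by rewrite mxE. Qed.

Lemma trD (A : pzRingType) m n (M N : 'M[A]_(m, n)) : (M + N)^T = M^T + N^T.
Proof. exact: linearD. Qed.

Lemma trN (A : pzRingType) m n (M : 'M[A]_(m, n)) : (- M)^T = - M^T.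
Proof. exact: linearN. Qed.

Lemma tr_sum_scale (A : pzRingType) m n (I : finType) (c : I -> A)
    (M : I -> 'M[A]_(m, n)) :
  (\sum_i c i *: M i)^T = \sum_i c i *: (M i)^T.
Proof. by rewrite linear_sum; apply: eq_bigr => i _; rewrite linearZ. Qed.

Ltac gen_entries :=
  repeat match goal with |- context [fun_of_matrix ?M ?i ?j] =>
    let x := fresh "x" in set x := fun_of_matrix M i j; clearbody x end.

Ltac mx_ring := apply/matrixP => ? ?; rewrite !(mxaddE, mxoppE, mxscaleE, mxzeroE);
  gen_entries; ring.

(** * Contraction of 2-tensors *)

Section Pairing.
Variables (A : comPzRingType) (n : nat).
Implicit Types (X Y F G H S : 'M[A]_n).

Definition pairing X F : A := \sum_(a < n) \sum_(b < n) X a b * F a b.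

(** As a trace, the contraction inherits linearity, and transposition and cyclicity replace the
    reindexing of double sums. *)
Lemma pairing_trace X F : pairing X F = \tr (X^T *m F).
Proof.
rewrite /pairing exchange_big /=; apply: eq_bigr => b _.
by rewrite mxE; apply: eq_bigr => a _; rewrite mxE.
Qed.

Lemma pairingDr X F G : pairing X (F + G) = pairing X F + pairing X G.
Proof. by rewrite !pairing_trace mulmxDr mxtraceD. Qed.

Lemma pairingNr X F : pairing X (- F) = - pairing X F.
Proof. by rewrite !pairing_trace mulmxN raddfN. Qed.

Lemma pairingBr X F G : pairing X (F - G) = pairing X F - pairing X G.
Proof. by rewrite pairingDr pairingNr. Qed.

Lemma pairing0 X : pairing X 0 = 0.
Proof. by rewrite -(subrr X) pairingBr subrr. Qed.

Lemma eq_pairing X F G : (forall a b, F a b = G a b) -> pairing X F = pairing X G.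
Proof. by move=> E; congr pairing; apply/matrixP. Qed.

Lemma pairingZr X (c : A) F : pairing X (c *: F) = c * pairing X F.
Proof. by rewrite !pairing_trace -scalemxAr mxtraceZ. Qed.

Lemma pairing_sumr (I : finType) X (F : I -> 'M[A]_n) :
  pairing X (\sum_i F i) = \sum_i pairing X (F i).
Proof.
rewrite pairing_trace mulmx_sumr raddf_sum.
by apply: eq_bigr => i _; rewrite pairing_trace.
Qed.

Lemma pairing_tr X F : pairing X^T F^T = pairing X F.
Proof. by rewrite !pairing_trace trmxK -mxtrace_tr trmx_mul trmxK mxtrace_mulC. Qed.

Lemma pairing_conj H X F :
  pairing (H *m X *m H^T) F = pairing X (H^T *m F *m H).
Proof.
by rewrite !pairing_trace !trmx_mul trmxK -!mulmxA mxtrace_mulC !mulmxA.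
Qed.

(** Transposing both factors shows that the contraction is its own opposite; [h], a half in the
    ring, turns 2p = 0 into p = 0. *)
Lemma pairing_sym_asym X F (h : A) : h + h = 1 ->
  X^T = X -> F^T = - F -> pairing X F = 0.
Proof.
move=> hh XT FT.
have E : pairing X F = - pairing X F by rewrite -[LHS]pairing_tr XT FT pairingNr.
have Z : pairing X F + pairing X F = 0 by rewrite {1}E addNr.
by rewrite -[LHS]mul1r -hh mulrDl -mulrDr Z mulr0.
Qed.

Lemma pairing_asym_sym X F (h : A) : h + h = 1 ->
  X^T = - X -> F^T = F -> pairing X F = 0.
Proof.
move=> hh XT FT; rewrite -(pairing_sym_asym (X := F) (F := X) hh) //.
by rewrite !pairing_trace mxtrace_mulC -mxtrace_tr !trmx_mul trmxK mxtrace_mulC.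
Qed.

End Pairing.

(** * Tensor calculus over a ring with commuting derivations *)

Section Derivations.
Variables (A : comPzRingType) (n : nat) (d : 'I_n -> A -> A).
Hypothesis dD : forall i, {morph d i : x y / x + y}.
Hypothesis dM : forall i x y, d i (x * y) = d i x * y + x * d i y.
Hypothesis dC : forall i j x, d i (d j x) = d j (d i x).

Lemma der0 i : d i 0 = 0.
Proof. by apply: (addrI (d i 0)); rewrite -dD !addr0. Qed.

Lemma derN i x : d i (- x) = - d i x.
Proof. by apply: (addrI (d i x)); rewrite -dD !subrr der0. Qed.

Lemma der_sum i (I : finType) (F : I -> A) :
  d i (\sum_j F j) = \sum_j d i (F j).
Proof. exact: (big_morph (d i) (dD i) (der0 i)). Qed.

Lemma der1 i : d i 1 = 0.
Proof.
by apply: (addrI (d i 1)); rewrite addr0 -{3}[1]mulr1 dM mulr1 mul1r.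
Qed.

Lemma der_nat i m : d i m%:R = 0.
Proof. by elim: m => [|m IH]; rewrite ?der0 // mulrS dD der1 IH addr0. Qed.

(** Makes normalization factors such as [kap] constant for every derivation: differentiate
    [c * m%:R = 1] and multiply by [c]. *)
Lemma der_inv_nat i c m : c * m%:R = 1 -> d i c = 0.
Proof.
move=> cm; have := dM i c m%:R; rewrite cm der1 der_nat mulr0 addr0 => E.
have -> : d i c = (d i c * m%:R) * c by rewrite -mulrA [_ * c]mulrC cm mulr1.
by rewrite -E mul0r.
Qed.

Definition dmx i (M : 'M[A]_n) : 'M[A]_n := map_mx (d i) M.

Lemma dmxD i M N : dmx i (M + N) = dmx i M + dmx i N.
Proof. by apply/matrixP => a b; rewrite !mxE dD. Qed.
Lemma dmxN i M : dmx i (- M) = - dmx i M.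
Proof. by apply/matrixP => a b; rewrite !mxE derN. Qed.
Lemma dmxZ i c M : dmx i (c *: M) = d i c *: M + c *: dmx i M.
Proof. by apply/matrixP => a b; rewrite !mxE dM. Qed.
Lemma dmx_tr i M : dmx i M^T = (dmx i M)^T.
Proof. by apply/matrixP => a b; rewrite !mxE. Qed.
Lemma dmxC i j M : dmx i (dmx j M) = dmx j (dmx i M).
Proof. by apply/matrixP => a b; rewrite !mxE dC. Qed.
Lemma dmxM i M N : dmx i (M *m N) = dmx i M *m N + M *m dmx i N.
Proof.
apply/matrixP => a b; rewrite !mxE der_sum -big_split /=.
by apply: eq_bigr => c _; rewrite dM !mxE.
Qed.
Lemma dmx1 i : dmx i 1%:M = 0.
Proof. by apply/matrixP => a b; rewrite !mxE der_nat. Qed.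
Lemma dmx_trace i M : d i (\tr M) = \tr (dmx i M).
Proof. by rewrite der_sum; apply: eq_bigr => a _; rewrite mxE. Qed.

(** * Covariant derivative and curvature of a torsion-free connection *)

Variable Gam : 'I_n -> 'M[A]_n.
Hypothesis Gam_sym : forall i j k, Gam i k j = Gam j k i.

(* Covariant derivative of a matrix with two lower indices, when
   [Gam i k j] is the connection coefficient Gamma^k_{ij}. *)
Definition cov i (T : 'M[A]_n) : 'M[A]_n :=
  dmx i T - (Gam i)^T *m T - T *m Gam i.

Lemma covD i S T : cov i (S + T) = cov i S + cov i T.
Proof. by rewrite /cov dmxD mulmxDr mulmxDl; mx_ring. Qed.
Lemma covN i T : cov i (- T) = - cov i T.
Proof. by rewrite /cov dmxN mulmxN mulNmx; mx_ring. Qed.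
Lemma covB i S T : cov i (S - T) = cov i S - cov i T.
Proof. by rewrite covD covN. Qed.
Lemma covZ i c T : cov i (c *: T) = d i c *: T + c *: cov i T.
Proof.
by rewrite /cov dmxZ -scalemxAr -scalemxAl; mx_ring.
Qed.
Lemma cov_tr i T : cov i T^T = (cov i T)^T.
Proof.
by rewrite /cov dmx_tr !(trD, trN) !trmx_mul trmxK; mx_ring.
Qed.

Lemma covE i T a b : cov i T a b =
  d i (T a b) - \sum_f Gam i f a * T f b - \sum_f T a f * Gam i f b.
Proof.
by rewrite !mxE; congr (_ - _ - _); apply: eq_bigr => f _; rewrite mxE.
Qed.

(* [Z] is the covariant derivative of the upper-index matrix [X]. *)
Lemma der_pairing i X Z F :
  dmx i X = Z - Gam i *m X - X *m (Gam i)^T ->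
  d i (pairing X F) = pairing Z F + pairing X (cov i F).
Proof.
move=> dX; rewrite !pairing_trace dmx_trace dmxM dmx_tr dX /cov.
have -> : (Z - Gam i *m X - X *m (Gam i)^T)^T =
    Z^T - X^T *m (Gam i)^T - Gam i *m X^T.
  by rewrite !(trD, trN) !trmx_mul trmxK.
have mxtraceN (P : 'M[A]_n) : \tr (- P) = - \tr P by rewrite raddfN.
rewrite !(mulmxBl, mulmxBr) !(mxtraceD, mxtraceN).
have <- : \tr (X^T *m F *m Gam i) = \tr (Gam i *m X^T *m F).
  by rewrite mxtrace_mulC mulmxA.
rewrite !mulmxA; ring.
Qed.

(** The commutator of the operators d_a + Gam_a and d_b + Gam_b; its entry (k, c) is R^k_{cab}. *)
Definition curv a b : 'M[A]_n :=
  dmx a (Gam b) - dmx b (Gam a) + Gam a *m Gam b - Gam b *m Gam a.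

Lemma curv_asym a b : curv b a = - curv a b.
Proof. by rewrite /curv; mx_ring. Qed.

(** The index of the inner [cov] is a mere label here. The connection term that it would receive is
    symmetric in [a] and [b] for a torsion-free connection, so this commutator is already the full
    Ricci identity. *)
Lemma cov_comm a b T :
  cov a (cov b T) - cov b (cov a T) = - ((curv a b)^T *m T) - T *m curv a b.
Proof.
rewrite /cov /curv.
rewrite !(dmxD, dmxN, dmxM, dmx_tr, dmxC b a).
rewrite !(trD, trN) !trmx_mul.
rewrite !(mulmxDl, mulmxDr, mulmxN, mulNmx, mulmxA).
mx_ring.
Qed.

(** By the symmetry of the connection coefficients in their lower indices, each derivative term and
    each product term occurs twice in the cyclic sum, with opposite signs. *)
Lemma first_bianchi a b c k :
  curv a b k c + curv b c k a + curv c a k b = 0.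
Proof.
have E i j l : dmx i (Gam j) k l = dmx i (Gam l) k j by rewrite !mxE Gam_sym.
have F i j l : (Gam i *m Gam j) k l = (Gam i *m Gam l) k j.
  by rewrite !mxE; apply: eq_bigr => f _; rewrite (Gam_sym j l).
rewrite /curv.
have mE (P Q S T : 'M[A]_n) i j : (P - Q + S - T) i j = P i j - Q i j + S i j - T i j.
  by rewrite !mxE.
rewrite !mE (E b a c) (F b a c) (E a b c) (F a b c) (E c a b) (F c a b).
ring.
Qed.

(** The Jacobi identity for the operators d_a + Gam_a. *)
Lemma second_bianchi a b c :
  (dmx a (curv b c) + Gam a *m curv b c - curv b c *m Gam a) +
  (dmx b (curv c a) + Gam b *m curv c a - curv c a *m Gam b) +
  (dmx c (curv a b) + Gam c *m curv a b - curv a b *m Gam c) = 0.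
Proof.
rewrite /curv !(dmxD, dmxN, dmxM) (dmxC b a) (dmxC c a) (dmxC c b).
rewrite !(mulmxDl, mulmxDr, mulmxN, mulNmx, mulmxA).
mx_ring.
Qed.

(** * Metric, lowered curvature and its symmetries *)

Variables (G H : 'M[A]_n) (half : A).
Hypothesis half2 : half + half = 1.
Hypothesis G_sym : G^T = G.
Hypothesis HG : H *m G = 1%:M.
Hypothesis cov_metric : forall i, cov i G = 0.

Lemma half_inj (x y : A) : x + x = y + y -> x = y.
Proof. by move=> E; rewrite -[x]mul1r -[y]mul1r -half2 !mulrDl -!mulrDr E. Qed.

Lemma GH : G *m H = 1%:M. Proof. exact: mulmx1C. Qed.

Lemma H_sym : H^T = H.
Proof.
have E : G *m H^T = 1%:M by rewrite -[in LHS]G_sym -trmx_mul HG trmx1.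
by rewrite -[LHS]mul1mx -HG -mulmxA E mulmx1.
Qed.

Lemma H_symE a b : H a b = H b a.
Proof. by rewrite -[in LHS]H_sym mxE. Qed.

Lemma dmx_metric i : dmx i G = (Gam i)^T *m G + G *m Gam i.
Proof. by apply/eqP; rewrite -subr_eq0 opprD addrA; apply/eqP/cov_metric. Qed.

Lemma dmx_inv_metric i : dmx i H = - (Gam i *m H) - H *m (Gam i)^T.
Proof.
have : dmx i (H *m G) *m H = 0 by rewrite HG dmx1 mul0mx.
rewrite dmxM mulmxDl -[_ *m G *m H]mulmxA GH mulmx1 => /eqP.
rewrite addr_eq0 => /eqP ->; rewrite dmx_metric mulmxDr mulmxDl.
have -> : H *m ((Gam i)^T *m G) *m H = H *m (Gam i)^T by rewrite -!mulmxA GH mulmx1.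
by rewrite mulmxA HG mul1mx opprD addrC.
Qed.

Lemma der_metric_pairing i F : d i (pairing H F) = pairing H (cov i F).
Proof.
rewrite (@der_pairing i H 0) ?dmx_inv_metric ?sub0r //.
by rewrite /pairing big1 ?add0r // => a _; rewrite big1 // => b _; rewrite mxE mul0r.
Qed.

Definition lcurv a b : 'M[A]_n := G *m curv a b.

Lemma curv_lower a b : curv a b = H *m lcurv a b.
Proof. by rewrite mulmxA HG mul1mx. Qed.

Lemma lcurv_asym a b : lcurv b a = - lcurv a b.
Proof. by rewrite /lcurv curv_asym mulmxN. Qed.

(** [G] is parallel, so the commutator of covariant derivatives kills it; written out, this is the
    antisymmetry of the lowered curvature in its matrix indices. *)
Lemma lcurv_tr a b : (lcurv a b)^T = - lcurv a b.
Proof.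
have E0 j : cov j (0 : 'M[A]_n) = 0.
  by rewrite -[X in cov j X](subrr G) covB cov_metric subrr.
have := cov_comm a b G; rewrite !cov_metric !E0 subrr /lcurv trmx_mul G_sym => /eqP.
by rewrite eq_sym -opprD oppr_eq0 addr_eq0 => /eqP.
Qed.

Lemma lcurv_trE a b i j : lcurv a b j i = - lcurv a b i j.
Proof. by rewrite -mxoppE -lcurv_tr [RHS]mxE. Qed.

Lemma lcurv_asymE a b i j : lcurv b a i j = - lcurv a b i j.
Proof. by rewrite lcurv_asym mxE. Qed.

Lemma lcurv_first_bianchi a b c k :
  lcurv a b k c + lcurv b c k a + lcurv c a k b = 0.
Proof.
rewrite /lcurv !mxE -!big_split big1 //= => f _.
by rewrite -!mulrDr first_bianchi mulr0.
Qed.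

Lemma lcurv_pair a b i j : lcurv a b i j = lcurv i j a b.
Proof.
have B1 := lcurv_first_bianchi a b j i.
have B2 := lcurv_first_bianchi a b i j.
have B3 := lcurv_first_bianchi i j b a.
have B4 := lcurv_first_bianchi i j a b.
have E p q r t : lcurv p q r t = lcurv q p t r.
  by rewrite lcurv_asymE lcurv_trE opprK.
apply: half_inj; apply/eqP; rewrite -subr_eq0; apply/eqP.
(* With entry (i, j) of [lcurv a b] read as R_{ijab}, the combination B1 - B2 - B3 + B4 of first
   Bianchi identities equals 2 R_{ijab} - 2 R_{abij}. It is assembled from the zeros on the
   right-hand side. *)
rewrite -[RHS](subrr 0) -{1}B1 -[X in _ = _ - X]addr0 -{1}B3.
rewrite -[X in _ = _ - (_ + X)](subrr 0) -{1}B2 -B4.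
rewrite (lcurv_trE a b i j) (lcurv_trE i j a b) (E j b a i).
rewrite (lcurv_trE j a i b) (lcurv_trE b i j a) (E a i b j).
gen_entries; ring.
Qed.

(** The covariant derivative in all four indices: [cov e] handles the matrix indices, the two sums
    handle the labels [a] and [b]. *)
Definition cov_lcurv e a b : 'M[A]_n := cov e (lcurv a b)
  - \sum_f Gam e f a *: lcurv f b - \sum_f Gam e f b *: lcurv a f.

Lemma cov_lcurvE e a b i j : cov_lcurv e a b i j =
  cov e (lcurv a b) i j - \sum_f Gam e f a * lcurv f b i j
  - \sum_f Gam e f b * lcurv a f i j.
Proof.
rewrite /cov_lcurv 2!mxsubE !summxE.
by congr (_ - _ - _); apply: eq_bigr => f _; rewrite mxscaleE.
Qed.

Lemma cov_lower i M :
  cov i (G *m M) = G *m (dmx i M + Gam i *m M - M *m Gam i).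
Proof.
rewrite /cov dmxM dmx_metric !(mulmxDl, mulmxDr, mulmxN, mulmxA); mx_ring.
Qed.

(** The connection terms of the labels cancel in pairs along the cycle ([S]), by torsion-freeness
    and antisymmetry. Since [G] is parallel, the rest is [G] times the second Bianchi identity. *)
Lemma cov_lcurv_bianchi a b c :
  cov_lcurv a b c + cov_lcurv b c a + cov_lcurv c a b = 0.
Proof.
have S i j k : \sum_f Gam i f j *: lcurv f k = - \sum_f Gam j f i *: lcurv k f.
  rewrite -sumrN; apply: eq_bigr => f _.
  by rewrite lcurv_asym scalerN Gam_sym.
pose B i j k := dmx i (curv j k) + Gam i *m curv j k - curv j k *m Gam i.
have E : G *m (B a b c + B b c a + B c a b) = 0.
  by rewrite /B second_bianchi mulmx0.
have covB i j k : cov i (lcurv j k) = G *m B i j k by exact: cov_lower.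
rewrite /cov_lcurv !covB (S a b c) (S b c a) (S c a b) -[RHS]E.
move: (B a b c) (B b c a) (B c a b) => X1 X2 X3.
by rewrite !mulmxDr; mx_ring.
Qed.

Lemma cov_lcurv_asym e a b : cov_lcurv e b a = - cov_lcurv e a b.
Proof.
rewrite /cov_lcurv (lcurv_asym a b) covN.
under eq_bigr => f _ do rewrite (lcurv_asym a f) scalerN.
under [X in _ - X]eq_bigr => f _ do rewrite (lcurv_asym f b) scalerN.
by rewrite !sumrN; mx_ring.
Qed.

Lemma cov_lcurv_tr e a b i j : cov_lcurv e a b j i = - cov_lcurv e a b i j.
Proof.
suff E : (cov_lcurv e a b)^T = - cov_lcurv e a b by rewrite -mxoppE -E [RHS]mxE.
rewrite /cov_lcurv 2!trD !trN -cov_tr lcurv_tr covN !tr_sum_scale.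
under eq_bigr => f _ do rewrite lcurv_tr scalerN.
under [X in _ - X]eq_bigr => f _ do rewrite lcurv_tr scalerN.
by rewrite !sumrN; mx_ring.
Qed.

(** * Ricci tensor and contracted Bianchi identity *)

Definition ric : 'M[A]_n := \matrix_(a, b) \sum_c curv c b c a.

Lemma ric_pairing a b : ric a b = pairing H (\matrix_(c, f) lcurv c b f a).
Proof.
rewrite mxE; apply: eq_bigr => c _; rewrite curv_lower mxE.
by apply: eq_bigr => f _; rewrite mxfunE.
Qed.

Lemma ric_sym : ric^T = ric.
Proof.
apply/matrixP => a b; rewrite mxE !ric_pairing -pairing_tr H_sym.
by congr pairing; apply/matrixP => c f; rewrite !(mxfunE, mxtrE) lcurv_pair.
Qed.

(** Contraction commutes with covariant differentiation because the inverse metric is parallel; the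
    rewriting only matches the connection terms index by index. *)
Lemma cov_ric e a b :
  cov e ric a b = pairing H (\matrix_(c, f) cov_lcurv e c b f a).
Proof.
rewrite covE ric_pairing der_metric_pairing.
have -> : \sum_f Gam e f a * ric f b =
    pairing H (\sum_f Gam e f a *: \matrix_(c, g) lcurv c b g f).
  by rewrite pairing_sumr; apply: eq_bigr => f _; rewrite pairingZr ric_pairing.
have -> : \sum_f ric a f * Gam e f b =
    pairing H (\sum_f Gam e f b *: \matrix_(c, g) lcurv c f g a).
  by rewrite pairing_sumr; apply: eq_bigr => f _; rewrite pairingZr ric_pairing mulrC.
rewrite -!pairingBr; congr pairing; apply/matrixP => c g.
rewrite 2!mxsubE [RHS]mxfunE cov_lcurvE !covE !summxE mxfunE.
have -> : \sum_f Gam e f c * (\matrix_(c0, f0) lcurv c0 b f0 a) f g =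
  \sum_f Gam e f c * lcurv f b g a.
  by apply: eq_bigr => f _; rewrite mxfunE.
have -> : \sum_f (\matrix_(c0, f0) lcurv c0 b f0 a) c f * Gam e f g =
  \sum_f Gam e f g * lcurv c b f a.
  by apply: eq_bigr => f _; rewrite mxfunE mulrC.
have -> : \sum_f (Gam e f a *: \matrix_(c0, g0) lcurv c0 b g0 f) c g =
  \sum_f lcurv c b g f * Gam e f a.
  by apply: eq_bigr => f _; rewrite mxscaleE mxfunE mulrC.
have -> : \sum_f (Gam e f b *: \matrix_(c0, g0) lcurv c0 f g0 a) c g =
  \sum_f Gam e f b * lcurv c f g a.
  by apply: eq_bigr => f _; rewrite mxscaleE mxfunE.
ring.
Qed.

Definition pairing2 (F : 'I_n -> 'I_n -> 'I_n -> 'I_n -> A) : A :=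
  pairing H (\matrix_(a, b) pairing H (\matrix_(c, f) F a b c f)).

Lemma pairing_H_tr F : pairing H F^T = pairing H F.
Proof. by rewrite -{1}H_sym pairing_tr. Qed.

Lemma pairing2_exchange F :
  pairing2 F = pairing2 (fun a b c f => F c f a b).
Proof.
rewrite /pairing2 /pairing.
transitivity (\sum_a \sum_b \sum_c \sum_f H a b * (H c f * F a b c f)).
  apply: eq_bigr => a _; apply: eq_bigr => b _; rewrite mxE mulr_sumr.
  by apply: eq_bigr => c _; rewrite mulr_sumr; apply: eq_bigr => f _; rewrite mxE.
under eq_bigr do rewrite exchange_big /=.
rewrite exchange_big /=; apply: eq_bigr => c _.
under eq_bigr => a _ do rewrite exchange_big /=.
rewrite exchange_big /=; apply: eq_bigr => f _; rewrite mxE mulr_sumr.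
apply: eq_bigr => a _; rewrite mulr_sumr; apply: eq_bigr => b _.
by rewrite mxE mulrCA.
Qed.

Lemma pairing2_add3 F1 F2 F3 :
  (forall a b c f, F1 a b c f + F2 a b c f + F3 a b c f = 0) ->
  pairing2 F1 + pairing2 F2 + pairing2 F3 = 0.
Proof.
move=> E; rewrite /pairing2 -!pairingDr -[RHS](pairing0 H).
apply: eq_pairing => a b.
rewrite 2!mxaddE mxzeroE !mxfunE -!pairingDr -[RHS](pairing0 H).
by apply: eq_pairing => c f; rewrite 2!mxaddE mxzeroE !mxfunE.
Qed.

Definition scal : A := pairing H ric.

Definition div_ric e : A := pairing H (\matrix_(b, a) cov b ric a e).

(** The second Bianchi identity contracted with two inverse metrics: one cyclic term gives the
    derivative of the scalar curvature, and each of the other two gives minus the divergence of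
    Ricci, by antisymmetry in one index pair. *)
Lemma contracted_bianchi e : d e scal = div_ric e + div_ric e.
Proof.
have E1 : pairing2 (fun b a c f => cov_lcurv e c b f a) = d e scal.
  rewrite der_metric_pairing -pairing_H_tr; apply: eq_pairing => b a.
  by rewrite !(mxfunE, mxtrE) cov_ric.
have E2 : pairing2 (fun b a c f => cov_lcurv c b e f a) = - div_ric e.
  rewrite pairing2_exchange /div_ric -pairingNr; apply: eq_pairing => c f.
  rewrite mxoppE !(mxfunE, mxtrE) cov_ric -pairingNr; apply: eq_pairing => b a.
  by rewrite mxoppE !(mxfunE, mxtrE) cov_lcurv_tr.
have E3 : pairing2 (fun b a c f => cov_lcurv b e c f a) = - div_ric e.
  rewrite /div_ric -pairingNr; apply: eq_pairing => b a.
  rewrite mxoppE !(mxfunE, mxtrE) cov_ric -pairingNr; apply: eq_pairing => c f.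
  by rewrite mxoppE !(mxfunE, mxtrE) cov_lcurv_asym mxoppE.
apply/eqP; rewrite -subr_eq0 opprD addrA -{1}E2 -E1 -E3; apply/eqP.
apply: pairing2_add3 => b a c f.
have := congr1 (fun M : 'M[A]_n => M f a) (cov_lcurv_bianchi e c b).
by rewrite 2!mxaddE mxzeroE.
Qed.

(** * Schouten tensor and its second derivatives *)

Variable kap : A.
Hypothesis kapE : kap * (2 * n.-1)%:R = 1.
Hypothesis n_gt0 : (0 < n)%N.

(** [kap] stands for 1/(2(n-1)), so this is the tensor A. *)
Definition sch : 'M[A]_n := ric - (scal * kap) *: G.

Lemma sch_sym : sch^T = sch.
Proof. by rewrite /sch trD trN linearZ /= ric_sym G_sym. Qed.

Lemma cov_sch_sym i : (cov i sch)^T = cov i sch.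
Proof. by rewrite -cov_tr sch_sym. Qed.

Lemma cov_sch_symE i a b : cov i sch a b = cov i sch b a.
Proof. by rewrite -{1}cov_sch_sym mxE. Qed.

Lemma pairing_metric : pairing H G = n%:R.
Proof. by rewrite pairing_trace H_sym HG mxtrace1. Qed.

Lemma cov_sch i : cov i sch = cov i ric - (d i scal * kap) *: G.
Proof.
rewrite /sch covB covZ cov_metric scaler0 addr0 dM.
by rewrite (der_inv_nat i kapE) mulr0 addr0.
Qed.

(** Both sides are (n-2)/(2(n-1)) times the derivative of the scalar curvature: on the left 1/2 -
    1/(2(n-1)), on the right 1 - n/(2(n-1)). *)
Lemma div_sch e :
  pairing H (\matrix_(b, a) cov b sch a e) = d e (pairing H sch).
Proof.
have -> : pairing H (\matrix_(b, a) cov b sch a e) = div_ric e - d e scal * kap.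
  rewrite /div_ric.
  have -> : d e scal * kap =
      pairing H (\matrix_(b, a) ((d b scal * kap) * G a e)).
    rewrite /pairing.
    transitivity (\sum_b (H *m G) b e * (d b scal * kap)).
      rewrite HG (bigD1 e) //= mxE eqxx mul1r big1 ?addr0 // => b be.
      by rewrite mxE (negbTE be) mul0r.
    apply: eq_bigr => b _; rewrite mxE mulr_suml; apply: eq_bigr => a _.
    by rewrite mxE -mulrA [G a e * _]mulrC.
  rewrite -pairingBr; apply: eq_pairing => b a.
  by rewrite mxaddE mxoppE !(mxfunE, mxtrE) cov_sch mxaddE mxoppE mxscaleE.
rewrite /sch pairingBr pairingZr pairing_metric -/scal dD derN !dM der_nat.
rewrite (der_inv_nat e kapE) contracted_bianchi.
(* What is left amounts to 2t [kap] (n-1) = t; doubled, it is [kapE] multiplied by 2t. *)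
set t := div_ric e; apply: half_inj.
have E : (t + t) * (kap * (2 * n.-1)%:R) = t + t by rewrite kapE mulr1.
have -> : n%:R = n.-1%:R + 1 :> A by rewrite natr1 prednK.
move: E; rewrite natrM => /eqP; rewrite -subr_eq0 => /eqP E.
by apply/eqP; rewrite -subr_eq0; apply/eqP; rewrite -[RHS]E; ring.
Qed.

Definition cov2_sch b c : 'M[A]_n :=
  cov b (cov c sch) - \sum_f Gam b f c *: cov f sch.

Lemma cov2_schE b c i j : cov2_sch b c i j =
  cov b (cov c sch) i j - \sum_f Gam b f c * cov f sch i j.
Proof.
rewrite /cov2_sch mxsubE summxE; congr (_ - _).
by apply: eq_bigr => f _; rewrite mxscaleE.
Qed.

Lemma cov2_sch_sym b c : (cov2_sch b c)^T = cov2_sch b c.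
Proof.
rewrite /cov2_sch trD trN -cov_tr cov_sch_sym tr_sum_scale.
by under eq_bigr => f _ do rewrite cov_sch_sym.
Qed.

Lemma cov2_sch_comm b c :
  cov2_sch b c = cov2_sch c b + lcurv b c *m H *m sch - sch *m H *m lcurv b c.
Proof.
have E := cov_comm b c sch; rewrite curv_lower in E.
rewrite trmx_mul H_sym lcurv_tr !mulNmx opprK [sch *m (_ *m _)]mulmxA in E.
have S : \sum_f Gam b f c *: cov f sch = \sum_f Gam c f b *: cov f sch.
  by apply: eq_bigr => f _; rewrite Gam_sym.
have -> : cov2_sch b c = cov b (cov c sch) - \sum_f Gam c f b *: cov f sch.
  by rewrite -S.
have -> : cov b (cov c sch) = cov c (cov b sch) +
    (lcurv b c *m H *m sch - sch *m H *m lcurv b c) by rewrite -E addrC subrK.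
rewrite /cov2_sch; move: (cov c _) (\sum_f _) => U V.
by rewrite -!addrA; congr (_ + _); rewrite addrA addrC.
Qed.

(* [div_sch] makes this contraction the Hessian of the trace of [sch]. *)
Lemma cov2_trace_sym p q :
  pairing H (\matrix_(e, a) cov2_sch q e p a) =
  pairing H (\matrix_(e, a) cov2_sch p e q a).
Proof.
set tau := pairing H sch.
suff E u v : pairing H (\matrix_(e, a) cov2_sch v e u a) =
    d v (d u tau) - \sum_f Gam v f u * d f tau.
  by rewrite !E dC; congr (_ - _); apply: eq_bigr => f _; rewrite Gam_sym.
rewrite -(div_sch u) der_metric_pairing.
have -> : \sum_f Gam v f u * d f tau =
  pairing H (\sum_f Gam v f u *: \matrix_(b, a) cov b sch a f).
  by rewrite pairing_sumr; apply: eq_bigr => f _; rewrite pairingZr div_sch.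
rewrite -pairingBr; apply: eq_pairing => e a.
rewrite mxsubE mxfunE cov2_schE [cov v (\matrix_(_, _) _) e a]covE.
rewrite [cov v (cov e sch) u a]covE summxE mxfunE (cov_sch_symE e a u).
have -> : \sum_f Gam v f e * (\matrix_(b0, a0) cov b0 sch a0 u) f a =
  \sum_f Gam v f e * cov f sch u a.
  by apply: eq_bigr => f _; rewrite mxfunE cov_sch_symE.
have -> : \sum_f (\matrix_(b0, a0) cov b0 sch a0 u) e f * Gam v f a =
  \sum_f cov e sch u f * Gam v f a.
  by apply: eq_bigr => f _; rewrite mxfunE cov_sch_symE.
have -> : \sum_f (Gam v f u *: \matrix_(b0, a0) cov b0 sch a0 f) e a =
  \sum_f Gam v f u * cov e sch f a.
  by apply: eq_bigr => f _; rewrite mxscaleE mxfunE cov_sch_symE.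
ring.
Qed.

Lemma pairing_lcurv_l (B : 'M[A]_n) p q : 
  pairing H (\matrix_(e, a) (lcurv e q *m B) p a) =
  \sum_e \sum_f lcurv e q p f * (B *m H) f e.
Proof.
apply: eq_bigr => e _.
under [RHS]eq_bigr => f _ do rewrite [X in _ * X]mxE mulr_sumr.
rewrite exchange_big /=; apply: eq_bigr => a _.
rewrite mxfunE [X in _ * X]mxE mulr_sumr.
by apply: eq_bigr => f _; rewrite (H_symE e a); ring.
Qed.

(** R_{pfeq} B^{fe} is symmetric in p and q: exchange e and f, apply pair symmetry, then change sign
    once in each antisymmetric pair. *)
Lemma sum_lcurv_sym (B : 'M[A]_n) p q : B^T = B ->
  \sum_e \sum_f lcurv e q p f * B f e = \sum_e \sum_f lcurv e p q f * B f e.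
Proof.
move=> BT; rewrite exchange_big /=; apply: eq_bigr => e _.
apply: eq_bigr => f _; have -> : B e f = B f e by rewrite -{1}BT mxE.
by rewrite (lcurv_pair f q) (lcurv_asymE e p) (lcurv_trE e p q f) opprK.
Qed.

Lemma pairing_lcurv_r (B : 'M[A]_n) p q :
  pairing H (\matrix_(e, a) (B *m lcurv e q) p a) = - (B *m ric) p q.
Proof.
have -> : pairing H (\matrix_(e, a) (B *m lcurv e q) p a) =
    pairing H (\sum_f B p f *: \matrix_(e, a) lcurv e q f a).
  apply: eq_pairing => e a; rewrite mxfunE summxE [LHS]mxE.
  by apply: eq_bigr => f _; rewrite mxscaleE mxfunE.
rewrite pairing_sumr [X in - X]mxE -sumrN; apply: eq_bigr => f _.
rewrite pairingZr ric_pairing -mulrN -pairingNr; congr (_ * _).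
by apply: eq_pairing => e a; rewrite mxoppE !(mxfunE, mxtrE) lcurv_trE.
Qed.

(** The heart of the first half. Commuting the derivatives in nabla^a nabla_q A_{pa} leaves the
    Hessian of tr A, a Riemann term contracted with A, and the product of A with Ricci; each of the
    three is symmetric in p and q. *)
Lemma cov2_div_sym p q :
  pairing H (\matrix_(e, a) cov2_sch e q p a) =
  pairing H (\matrix_(e, a) cov2_sch e p q a).
Proof.
have E u v : pairing H (\matrix_(e, a) cov2_sch e v u a) =
  pairing H (\matrix_(e, a) cov2_sch v e u a) +
  \sum_e \sum_f lcurv e v u f * (H *m sch *m H) f e +
  (sch *m H *m ric) u v.
  rewrite -pairing_lcurv_l -[X in _ + X]opprK -pairing_lcurv_r -pairingDr -pairingBr.
  apply: eq_pairing => e a; rewrite mxsubE mxaddE !mxfunE cov2_sch_comm.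
  by rewrite mxsubE mxaddE -!mulmxA.
rewrite !E cov2_trace_sym (sum_lcurv_sym p q); last first.
  by rewrite !trmx_mul H_sym sch_sym mulmxA.
congr (_ + _).
(* Here the form of A matters: with A = Ric - cg the product is Ric H Ric - c Ric, a symmetric
   matrix. *)
have T : (sch *m H *m ric)^T = sch *m H *m ric.
  rewrite !trmx_mul H_sym sch_sym ric_sym /sch.
  rewrite !mulmxBr !mulmxBl -!scalemxAr -!scalemxAl HG GH.
  by rewrite mulmx1 mul1mx mulmxA.
by rewrite -{1}T mxE.
Qed.

(** Entry (b, c) of [cot a] is C_{bca}. The index of the current is the label, so that the matrix
    pairs with Y^{bc}. *)
Definition cot a : 'M[A]_n := \matrix_(b, c) (cov a sch b c - cov c sch b a).

(** The trace is nabla^a A_{ac} - nabla_c tr A, which vanishes by [div_sch]. *)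
Lemma cot_trace c : pairing H (\matrix_(a, b) cot a b c) = 0.
Proof.
have -> : pairing H (\matrix_(a, b) cot a b c) =
    pairing H (\matrix_(a, b) cov a sch b c) - pairing H (cov c sch).
  rewrite -pairingBr; apply: eq_pairing => a b.
  by rewrite mxsubE !mxfunE (cov_sch_symE c a b).
by rewrite div_sch der_metric_pairing subrr.
Qed.

Lemma cov_cot e a p q :
  (cov e (cot a) - \sum_f Gam e f a *: cot f) p q =
  cov2_sch e a p q - cov2_sch e q p a.
Proof.
rewrite mxsubE !cov2_schE summxE [cov e (cot a) p q]covE.
rewrite [cov e (cov a sch) p q]covE [cov e (cov q sch) p a]covE [cot a p q]mxE dD derN.
have -> : \sum_f Gam e f p * cot a f q =
  \sum_f Gam e f p * cov a sch f q - \sum_f Gam e f p * cov q sch f a.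
  by rewrite -sumrB; apply: eq_bigr => f _; rewrite mxE mulrBr.
have -> : \sum_f cot a p f * Gam e f q =
  \sum_f cov a sch p f * Gam e f q - \sum_f Gam e f q * cov f sch p a.
  by rewrite -sumrB; apply: eq_bigr => f _; rewrite mxE; ring.
have -> : \sum_f (Gam e f a *: cot f) p q =
  \sum_f Gam e f a * cov f sch p q - \sum_f cov q sch p f * Gam e f a.
  by rewrite -sumrB; apply: eq_bigr => f _; rewrite mxscaleE mxE; ring.
ring.
Qed.

(** * The current and its divergence *)

Variable Y : 'M[A]_n.
Hypothesis Y_asym : Y^T = - Y.

Definition raised : 'M[A]_n := H *m Y *m H^T.

Definition current a : A := pairing raised (cot a).

(** Raising commutes with differentiation as the inverse metric is parallel; the shape is the one
    that [der_pairing] expects. *)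
Lemma dmx_raised e :
  dmx e raised = H *m cov e Y *m H^T - Gam e *m raised - raised *m (Gam e)^T.
Proof.
rewrite /raised H_sym !dmxM dmx_inv_metric /cov.
rewrite !(mulmxDl, mulmxDr, mulmxN, mulNmx, mulmxA); mx_ring.
Qed.

Definition div_current : A :=
  \sum_a \sum_b H a b * (d b (current a) - \sum_f Gam b f a * current f).

(** Disposes of the term (nabla^a C_{bca}) Y^{bc}: the matrix [S] of nabla^a C_{bca} is symmetric,
    by the symmetry of A and [cov2_div_sym], whereas the raised [Y] is antisymmetric. *)
Lemma div_currentE : div_current =
  \sum_a \sum_b H a b * pairing (cov b Y) (H *m cot a *m H).
Proof.
pose S : 'M[A]_n := \sum_a \sum_b H a b *:
   (cov b (cot a) - \sum_f Gam b f a *: cot f).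
have S_sym : S^T = S.
  have SE p q : S p q = pairing H (\matrix_(a, b) cov2_sch b a p q)
     - pairing H (\matrix_(e, a) cov2_sch e q p a).
    rewrite -[X in _ - X]pairing_H_tr -pairingBr /S summxE; apply: eq_bigr => a _.
    rewrite summxE; apply: eq_bigr => b _.
    by rewrite mxscaleE cov_cot [in RHS]mxsubE mxtrE !mxfunE.
  apply/matrixP => p q; rewrite mxE !SE cov2_div_sym; congr (_ - _).
  by apply: eq_pairing => a b; rewrite !(mxfunE, mxtrE) -{1}cov2_sch_sym mxE.
have raised_asym : raised^T = - raised.
  by rewrite /raised !trmx_mul trmxK Y_asym mulNmx mulmxN H_sym mulmxA.
transitivity (\sum_a \sum_b H a b * pairing (cov b Y) (H *m cot a *m H)
   + pairing raised S); last by rewrite (pairing_asym_sym half2) // addr0.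
rewrite /S pairing_sumr -big_split; apply: eq_bigr => a _ /=.
rewrite pairing_sumr -big_split; apply: eq_bigr => b _ /=.
rewrite pairingZr -mulrDr; congr (_ * _).
rewrite (der_pairing _ (dmx_raised b)) pairing_conj H_sym.
rewrite [in RHS]pairingBr pairing_sumr.
rewrite -addrA; congr (_ + (_ - _)).
by apply: eq_bigr => f _; rewrite pairingZr.
Qed.

(** * Contraction of the Cotton tensor with the CKY equation *)

Variables (xi : 'I_n -> A) (z : 'I_n -> 'I_n -> 'I_n -> A).
Hypothesis z_asym12 : forall p q e, z q p e = - z p q e.
Hypothesis z_asym23 : forall p q e, z p e q = - z p q e.
Hypothesis cky : forall e p q,
  cov e Y p q = G e p * xi q - G e q * xi p + z p q e.

Lemma conj_entryE (M : 'M[A]_n) i j :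
  (H *m M *m H) i j = \sum_t \sum_s H i s * M s t * H t j.
Proof. by rewrite mxE; apply: eq_bigr => t _; rewrite mxE mulr_suml. Qed.

Lemma conj_cot_trace1 q : \sum_a (H *m cot a *m H) a q = 0.
Proof.
under eq_bigr do rewrite conj_entryE; rewrite exchange_big /= big1 // => t _.
transitivity (pairing H (\matrix_(a, s) cot a s t) * H t q).
  rewrite /pairing mulr_suml; apply: eq_bigr => a _; rewrite mulr_suml.
  by apply: eq_bigr => s _; rewrite [in RHS]mxfunE.
by rewrite cot_trace mul0r.
Qed.

Lemma conj_cot_trace2 p : \sum_a (H *m cot a *m H) p a = 0.
Proof.
under eq_bigr do rewrite conj_entryE exchange_big /=.
rewrite exchange_big /= big1 // => s _.
transitivity (H p s * pairing H (\matrix_(a, t) cot a s t)).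
  rewrite /pairing mulr_sumr; apply: eq_bigr => a _; rewrite mulr_sumr.
  by apply: eq_bigr => t _; rewrite [in RHS]mxfunE (H_symE t a); ring.
rewrite (pairing_sym_asym half2 H_sym) ?mulr0 //.
by apply/matrixP => a t; rewrite mxtrE mxoppE !mxfunE opprB.
Qed.

Lemma conj_sch_asym (Z : 'M[A]_n) i :
  Z^T = - Z -> pairing Z (H *m cov i sch *m H) = 0.
Proof.
move=> ZT; apply: (pairing_asym_sym half2) => //.
by rewrite !trmx_mul H_sym cov_sch_sym mulmxA.
Qed.

(** In C_{pqa} = nabla_a A_{pq} - nabla_q A_{pa} each term is symmetric in two indices in which [z]
    is antisymmetric. *)
Lemma pairing_z_cot :
  \sum_a \sum_b H a b *
    pairing (\matrix_(p, q) z p q b) (H *m cot a *m H) = 0.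
Proof.
pose Nt a : 'M[A]_n := \matrix_(s, t) cov t sch s a.
have -> : \sum_a \sum_b H a b *
    pairing (\matrix_(p, q) z p q b) (H *m cot a *m H) =
  - \sum_a \sum_b H a b *
    pairing (\matrix_(p, q) z p q b) (H *m Nt a *m H).
  rewrite -sumrN; apply: eq_bigr => a _; rewrite -sumrN; apply: eq_bigr => b _.
  have -> : cot a = cov a sch - Nt a.
    by apply/matrixP => s t; rewrite mxsubE !mxfunE.
  rewrite mulmxBr mulmxBl pairingBr conj_sch_asym ?sub0r ?mulrN //.
  by apply/matrixP => p q; rewrite mxtrE mxoppE !mxfunE z_asym12.
apply/eqP; rewrite oppr_eq0; apply/eqP.
(* In the remaining term the derivative sits on q and the symmetric pair is p, a. Moving the sums
   over q and t outside leaves an antisymmetric slice of [z] paired with a raised [cov t sch]. *)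
transitivity (\sum_q \sum_t H t q *
   pairing (\matrix_(p, b) z p q b) (H *m cov t sch *m H)).
  pose F a b p q t s := H a b * (z p q b * (H p s * cov t sch s a * H t q)).
  transitivity (\sum_a \sum_b \sum_p \sum_q \sum_t \sum_s F a b p q t s).
    apply: eq_bigr => a _; apply: eq_bigr => b _; rewrite mulr_sumr.
    apply: eq_bigr => p _; rewrite mulr_sumr; apply: eq_bigr => q _.
    rewrite mxfunE conj_entryE mulr_sumr mulr_sumr; apply: eq_bigr => t _.
    by rewrite !mulr_sumr; apply: eq_bigr => s _; rewrite mxfunE.
  transitivity (\sum_q \sum_t \sum_p \sum_b \sum_a \sum_s F a b p q t s).
    under eq_bigr => a _ do under eq_bigr => b _ do rewrite exchange_big /=.
    under eq_bigr => a _ do rewrite exchange_big /=.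
    rewrite exchange_big /=; apply: eq_bigr => q _.
    under eq_bigr => a _ do under eq_bigr => b _ do rewrite exchange_big /=.
    under eq_bigr => a _ do rewrite exchange_big /=.
    rewrite exchange_big /=; apply: eq_bigr => t _.
    under eq_bigr => a _ do rewrite exchange_big /=.
    rewrite exchange_big /=; apply: eq_bigr => p _.
    by rewrite exchange_big.
  apply: eq_bigr => q _; apply: eq_bigr => t _; rewrite mulr_sumr.
  apply: eq_bigr => p _; rewrite mulr_sumr; apply: eq_bigr => b _.
  rewrite mxfunE conj_entryE mulr_sumr mulr_sumr; apply: eq_bigr => a _.
  by rewrite !mulr_sumr; apply: eq_bigr => s _; rewrite /F; ring.
rewrite big1 // => q _; rewrite big1 // => t _.
rewrite conj_sch_asym ?mulr0 //.
by apply/matrixP => p b; rewrite mxtrE mxoppE !mxfunE (z_asym12 q b)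
  (z_asym23 q p) (z_asym12 p q) opprK.
Qed.

Theorem div_current_eq0 : div_current = 0.
Proof.
rewrite div_currentE.
have HGE a p : \sum_b H a b * G b p = (a == p)%:R.
  by have := congr1 (fun M : 'M[A]_n => M a p) HG; rewrite !mxE.
(* By [HGE] the metric in each [xi] term contracts to a Kronecker delta, which leaves a trace of the
   raised Cotton tensor over the label and its first or second matrix index. *)
transitivity (\sum_a \sum_b H a b *
    pairing (\matrix_(p, q) (G b p * xi q)) (H *m cot a *m H)
  - \sum_a \sum_b H a b *
    pairing (\matrix_(p, q) (G b q * xi p)) (H *m cot a *m H)
  + \sum_a \sum_b H a b *
    pairing (\matrix_(p, q) z p q b) (H *m cot a *m H)).
  rewrite -sumrB -big_split; apply: eq_bigr => a _ /=.
  rewrite -sumrB -big_split; apply: eq_bigr => b _ /=.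
  rewrite -mulrBr -mulrDr; congr (_ * _); rewrite /pairing.
  rewrite -sumrB -big_split; apply: eq_bigr => p _ /=.
  rewrite -sumrB -big_split; apply: eq_bigr => q _ /=.
  by rewrite cky !mxfunE; ring.
rewrite pairing_z_cot addr0.
have E1 : \sum_a \sum_b H a b *
    pairing (\matrix_(p, q) (G b p * xi q)) (H *m cot a *m H) =
    \sum_q xi q * \sum_a (H *m cot a *m H) a q.
  under [RHS]eq_bigr do rewrite mulr_sumr.
  rewrite [RHS]exchange_big /=; apply: eq_bigr => a _.
  transitivity (\sum_p (\sum_b H a b * G b p) *
      \sum_q xi q * (H *m cot a *m H) p q).
    under [RHS]eq_bigr do rewrite mulr_suml.
    rewrite [RHS]exchange_big /=; apply: eq_bigr => b _.
    rewrite mulr_sumr; apply: eq_bigr => p _; rewrite -mulrA; congr (_ * _).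
    by rewrite mulr_sumr; apply: eq_bigr => q _; rewrite mxfunE mulrA.
  rewrite (bigD1 a) //= HGE eqxx mul1r [X in _ + X]big1 ?addr0 // => p pa.
  by rewrite HGE eq_sym (negbTE pa) mul0r.
have E2 : \sum_a \sum_b H a b *
    pairing (\matrix_(p, q) (G b q * xi p)) (H *m cot a *m H) =
    \sum_p xi p * \sum_a (H *m cot a *m H) p a.
  under [RHS]eq_bigr do rewrite mulr_sumr.
  rewrite [RHS]exchange_big /=; apply: eq_bigr => a _.
  transitivity (\sum_q (\sum_b H a b * G b q) *
      \sum_p xi p * (H *m cot a *m H) p q).
    under [RHS]eq_bigr do rewrite mulr_suml.
    rewrite [RHS]exchange_big /=; apply: eq_bigr => b _.
    rewrite /pairing exchange_big mulr_sumr; apply: eq_bigr => q _ /=.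
    rewrite -mulrA; congr (_ * _).
    by rewrite mulr_sumr; apply: eq_bigr => p _; rewrite mxfunE mulrA.
  rewrite (bigD1 a) //= HGE eqxx mul1r [X in _ + X]big1 ?addr0 // => p pa.
  by rewrite HGE eq_sym (negbTE pa) mul0r.
rewrite E1 E2 [X in X - _]big1; last by move=> q _; rewrite conj_cot_trace1 mulr0.
by rewrite big1 ?subrr // => p _; rewrite conj_cot_trace2 mulr0.
Qed.

End Derivations.

(** * Symmetry of second derivatives *)

Section MixedDerivatives.
Variables (R : realType) (V : normedModType R).
Implicit Types (f : V -> R) (x y u v w : V) (s t : R).

Lemma is_derive_line f y v s : derivable f (s *: v + y) v ->
  is_derive s 1 (fun r : R => f (r *: v + y)) ('D_v f (s *: v + y)).
Proof.
have E : (fun h : R => h^-1 *: (((fun r : R => f (r *: v + y)) \o shift s) (h *: 1)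
      - f (s *: v + y))) =
    (fun h : R => h^-1 *: ((f \o shift (s *: v + y)) (h *: v) - f (s *: v + y))).
  by apply: funext => h /=; rewrite scaler1 scalerDl addrA.
move=> df; split; first by rewrite /derivable E.
by rewrite /derive E.
Qed.

Lemma MVT_line f y v t : 0 < t ->
  (forall s, 0 <= s <= t -> derivable f (s *: v + y) v) ->
  exists2 c, 0 <= c <= t & f (t *: v + y) - f y = t * 'D_v f (c *: v + y).
Proof.
move=> t0 df.
have [||c] := @MVT _ (fun r : R => f (r *: v + y))
    (fun r => 'D_v f (r *: v + y)) 0 t t0.
- move=> s; rewrite in_itv /= => /andP[s0 st].
  by apply: is_derive_line; apply: df; rewrite !ltW.
- apply: derivable_within_continuous => s; rewrite in_itv /= => st.
  by have [] := is_derive_line (df s st).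
rewrite in_itv /= => /andP[c0 ct]; rewrite scale0r add0r subr0 => E.
by exists c; rewrite ?ltW // E mulrC.
Qed.

Lemma is_derive_translate f w y u : derivable f (y + w) u ->
  is_derive y u (fun z => f (z + w)) ('D_u f (y + w)).
Proof.
have E : (fun h : R => h^-1 *: (((fun z => f (z + w)) \o shift y) (h *: u)
      - f (y + w))) =
    (fun h : R => h^-1 *: ((f \o shift (y + w)) (h *: u) - f (y + w))).
  by apply: funext => h /=; rewrite addrA.
move=> df; split; first by rewrite /derivable E.
by rewrite /derive E.
Qed.

(** The mean value theorem used twice: along [u] for the increment [psi] in direction [v], then
    along [v] for ['D_u f]. *)
Lemma second_difference f x u v t : 0 < t ->
  (forall a b, 0 <= a <= t -> 0 <= b <= t ->
     derivable f (b *: v + (a *: u + x)) u /\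
     derivable ('D_u f) (b *: v + (a *: u + x)) v) ->
  exists a b, [/\ 0 <= a <= t, 0 <= b <= t &
    f (t *: v + (t *: u + x)) - f (t *: u + x) - (f (t *: v + x) - f x) =
    t * (t * 'D_v ('D_u f) (b *: v + (a *: u + x)))].
Proof.
move=> t0 df.
have t00 : 0 <= (0 : R) <= t by rewrite lexx ltW.
have tt : 0 <= t <= t by rewrite lexx ltW.
pose psi y := f (y + t *: v) - f y.
have dpsi a : 0 <= a <= t -> is_derive (a *: u + x) u psi
   ('D_u f (t *: v + (a *: u + x)) - 'D_u f (a *: u + x)).
  move=> at0; rewrite [t *: v + _]addrC; apply: is_deriveB.
    by apply: is_derive_translate; rewrite addrC; exact: (df a t at0 tt).1.
  by apply: derivableP; have := (df a 0 at0 t00).1; rewrite scale0r add0r.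
have [a at0 Ea] := @MVT_line psi x u t t0
  (fun s st => @ex_derive _ _ _ _ _ _ _ (dpsi s st)).
have [b bt0 Eb] := @MVT_line ('D_u f) (a *: u + x) v t t0
  (fun s st => (df a s at0 st).2).
exists a, b; split => //.
by rewrite -Eb -(@derive_val _ _ _ _ _ _ _ (dpsi a at0)) -Ea /psi ![_ + t *: v]addrC.
Qed.

(** The second difference over a small parallelogram does not depend on the order of [u] and [v], so
    the two mixed derivatives agree at a pair of points near [x]; continuity at [x] carries this
    over to [x] up to any [e]. *)
Lemma derive_comm (U : set V) f x u v : open U -> U x ->
  (forall y, U y -> derivable f y u /\ derivable f y v) ->
  (forall y, U y -> derivable ('D_u f) y v /\ derivable ('D_v f) y u) ->
  {for x, continuous ('D_v ('D_u f))} -> {for x, continuous ('D_u ('D_v f))} ->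
  'D_v ('D_u f) x = 'D_u ('D_v f) x.
Proof.
move=> Uo Ux df ddf c1 c2.
apply/eqP; rewrite -subr_eq0 -normr_le0; apply/ler_addgt0Pl => e e0.
rewrite addr0.
have e20 : 0 < e / 2 by rewrite divr_gt0.
have NU : nbhs x U by exact: open_nbhs_nbhs.
move/cvgrPdist_lt: c1 => /(_ _ e20) N1; move/cvgrPdist_lt: c2 => /(_ _ e20) N2.
have [r /= r0 rP] := (nbhs_ballP _ _).1 (filterI NU (filterI N1 N2)).
(* Small enough to keep the whole parallelogram inside the ball of radius [r]; the added 1 keeps the
   divisor positive when [u] and [v] vanish. *)
pose t := r / 2 / (`|u| + `|v| + 1).
have D0 : 0 < `|u| + `|v| + 1 by rewrite ltr_wpDl // addr_ge0.
have t0 : 0 < t by rewrite !divr_gt0.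
have near_x a b : 0 <= a <= t -> 0 <= b <= t -> ball x r (b *: v + (a *: u + x)).
  move=> /andP[a0 at0] /andP[b0 bt0]; rewrite -ball_normE /=.
  rewrite addrA opprD addrCA subrr addr0 normrN.
  apply: le_lt_trans (ler_normD _ _) _; rewrite !normrZ !ger0_norm //.
  apply: (@le_lt_trans _ _ (t * (`|u| + `|v| + 1))).
    rewrite !mulrDr mulr1 [t * _ + _]addrC -[leLHS]addr0.
    by rewrite lerD ?(ltW t0) // lerD // ler_wpM2r.
  by rewrite /t divfK ?gt_eqF // ltr_pdivrMr // ltr_pMr // ltr1n.
have [|a [b [at0 bt0 Eab]]] := @second_difference f x u v t t0.
  move=> a b at0 bt0; have [Uy _] := rP _ (near_x a b at0 bt0).
  by split; [exact: (df _ Uy).1 | exact: (ddf _ Uy).1].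
have swap c d : d *: u + (c *: v + x) = c *: v + (d *: u + x) by rewrite addrCA.
have [|a' [b' [at0' bt0' Eab']]] := @second_difference f x v u t t0.
  move=> a' b' at0' bt0'; rewrite swap.
  have [Uy _] := rP _ (near_x b' a' bt0' at0').
  by split; [exact: (df _ Uy).2 | exact: (ddf _ Uy).2].
rewrite !swap in Eab'.
have swap4 (p q r' s' : R) : p - q - (r' - s') = p - r' - (q - s') by ring.
have E : 'D_v ('D_u f) (b *: v + (a *: u + x)) =
    'D_u ('D_v f) (a' *: v + (b' *: u + x)).
  apply: (mulfI (lt0r_neq0 t0)); apply: (mulfI (lt0r_neq0 t0)).
  exact: etrans (esym Eab) (etrans (swap4 _ _ _ _) Eab').
have [_ [H1 _]] := rP _ (near_x a b at0 bt0).
have [_ [_ H2]] := rP _ (near_x b' a' bt0' at0').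
rewrite E in H1; move: H1 H2.
move: ('D_u ('D_v f) (a' *: v + (b' *: u + x))) => m.
move: ('D_v ('D_u f) x) ('D_u ('D_v f) x) => p q H1 H2.
apply: le_trans (ler_distD m _ _) _; rewrite [`|m - q|]distrC [leRHS]splitr.
exact: lerD (ltW H1) (ltW H2).
Qed.

End MixedDerivatives.

(** * Smooth functions on an open set *)

Section SmoothClosure.
Variables (R : realType) (n : nat) (U : set 'rV[R]_n).
Hypothesis U_open : open U.
Implicit Types (f g : 'rV[R]_n -> R) (k : nat).

Lemma near_open (P : 'rV[R]_n -> Prop) x : (forall y, U y -> P y) -> U x ->
  \near x, P x.
Proof.
by move=> UP Ux; have := open_nbhs_nbhs (conj U_open Ux); apply: filterS.
Qed.

Lemma partial_eq i f g : (forall y, U y -> f y = g y) ->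
  forall x, U x -> partial i f x = partial i g x.
Proof. by move=> fg x Ux; apply: near_eq_derive; exact: near_open. Qed.

Lemma Ck_continuous k f : Ck k U f -> forall x, U x -> {for x, continuous f}.
Proof. by case: k => [|k] []. Qed.

Lemma Ck_derivable k f i : Ck k.+1 U f ->
  forall x, U x -> derivable f x (delta_mx 0 i).
Proof. by move=> [_ /(_ i)[]]. Qed.

Lemma Ck_partial k f i : Ck k.+1 U f -> Ck k U (partial i f).
Proof. by move=> [_ /(_ i)[]]. Qed.

Arguments Ck_continuous [k f] _ x _.
Arguments Ck_derivable [k f] i _ x _.
Arguments Ck_partial [k f] i _.

Lemma CkW k f : Ck k.+1 U f -> Ck k U f.
Proof.
elim: k f => [|k IH] f Cf; first by split=> // x; exact: Ck_continuous Cf x.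
split=> [x|i]; first exact: Ck_continuous Cf x.
by split=> [x|]; [exact: Ck_derivable Cf x | apply: IH; exact: Ck_partial Cf].
Qed.

Lemma CkS k f : (forall x, U x -> {for x, continuous f}) ->
  (forall i x, U x -> derivable f x (delta_mx 0 i)) ->
  (forall i, Ck k U (partial i f)) -> Ck k.+1 U f.
Proof. by move=> fc fd fp; split=> // i; split; [exact: fd | exact: fp]. Qed.

Lemma continuous_eq f g : (forall y, U y -> f y = g y) ->
  forall x, U x -> {for x, continuous f} -> {for x, continuous g}.
Proof.
move=> fg x Ux fc; have : g @ x --> f x; last by rewrite fg.
apply: cvg_trans fc; apply: (@near_eq_cvg _ _ (nbhs x)).
by apply: near_open Ux => y Uy; rewrite /= fg.
Qed.

(** Since [U] is open, a derivative on [U] depends only on values on [U]. The closure lemmas need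
    this because the derivative rules hold only there. *)
Lemma eq_Ck k f g : (forall x, U x -> f x = g x) -> Ck k U f -> Ck k U g.
Proof.
elim: k f g => [|k IH] f g fg Cf.
  by split=> // x Ux; apply: (continuous_eq fg Ux); exact: Ck_continuous Cf x Ux.
apply: CkS => [x Ux|i x Ux|i].
- by apply: (continuous_eq fg Ux); exact: Ck_continuous Cf x Ux.
- have E : {near x, f =1 g} by exact: near_open Ux.
  exact: near_eq_derivable E (Ck_derivable i Cf x Ux).
- by apply: IH (Ck_partial i Cf) => x Ux; apply: partial_eq.
Qed.

Lemma Ck_cst k (c : R) : Ck k U (cst c).
Proof.
elim: k c => [|k IH] c; first by split=> // x _; exact: cst_continuous.
apply: CkS => [x _|i x _|i]; [exact: cst_continuous | exact: derivable_cst |].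
by apply: eq_Ck (IH 0) => x _; rewrite /partial derive_cst.
Qed.

Lemma CkD k f g : Ck k U f -> Ck k U g -> Ck k U (f + g).
Proof.
elim: k f g => [|k IH] f g Cf Cg.
  split=> // x Ux; apply: continuousD; first exact: Ck_continuous Cf x Ux.
  exact: Ck_continuous Cg x Ux.
apply: CkS => [x Ux|i x Ux|i].
- by apply: continuousD; [exact: Ck_continuous Cf x Ux | exact: Ck_continuous Cg x Ux].
- by apply: derivableD; [exact: Ck_derivable Cf x Ux | exact: Ck_derivable Cg x Ux].
apply: eq_Ck (IH _ _ (Ck_partial i Cf) (Ck_partial i Cg)) => x Ux.
rewrite /partial deriveD //.
- exact: Ck_derivable Cf x Ux.
- exact: Ck_derivable Cg x Ux.
Qed.

Lemma CkM k f g : Ck k U f -> Ck k U g -> Ck k U (f * g).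
Proof.
elim: k f g => [|k IH] f g Cf Cg.
  split=> // x Ux; apply: continuousM; first exact: Ck_continuous Cf x Ux.
  exact: Ck_continuous Cg x Ux.
apply: CkS => [x Ux|i x Ux|i].
- by apply: continuousM; [exact: Ck_continuous Cf x Ux | exact: Ck_continuous Cg x Ux].
- by apply: derivableM; [exact: Ck_derivable Cf x Ux | exact: Ck_derivable Cg x Ux].
apply: eq_Ck (CkD (IH _ _ (CkW Cf) (Ck_partial i Cg))
  (IH _ _ (CkW Cg) (Ck_partial i Cf))) => x Ux.
rewrite /partial deriveM //.
- exact: Ck_derivable Cf x Ux.
- exact: Ck_derivable Cg x Ux.
Qed.

Lemma CkV k f : (forall x, U x -> f x != 0) -> Ck k U f ->
  Ck k U (fun x => (f x)^-1).
Proof.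
move=> f0; elim: k => [|k IH] Cf.
  by split=> // x Ux; apply: continuousV; [exact: f0 | exact: Ck_continuous Cf x Ux].
apply: CkS => [x Ux|i x Ux|i].
- by apply: continuousV; [exact: f0 | exact: Ck_continuous Cf x Ux].
- by apply: derivableV; [exact: f0 | exact: Ck_derivable Cf x Ux].
(* The derivative of the inverse is minus its square times the derivative of [f], so the inverse is
   needed only to order [k]. *)
have Cv := IH (CkW Cf).
apply: eq_Ck (CkM (CkM (Ck_cst k (-1)) (CkM Cv Cv)) (Ck_partial i Cf)) => x Ux.
rewrite /partial deriveV; [|exact: f0|exact: Ck_derivable Cf x Ux].
by rewrite !fctE -invfM -expr2 mulN1r.
Qed.

Lemma smooth_partial f i : smooth U f -> smooth U (partial i f).
Proof. by move=> sf k; exact: Ck_partial (sf k.+1). Qed.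

Lemma eq_smooth f g : (forall x, U x -> f x = g x) -> smooth U f -> smooth U g.
Proof. by move=> fg sf k; exact: eq_Ck fg (sf k). Qed.

Lemma smooth_cst (c : R) : smooth U (cst c).
Proof. by move=> k; exact: Ck_cst. Qed.

Lemma smoothD f g : smooth U f -> smooth U g -> smooth U (f + g).
Proof. by move=> sf sg k; exact: CkD. Qed.

Lemma smoothM f g : smooth U f -> smooth U g -> smooth U (f * g).
Proof. by move=> sf sg k; exact: CkM. Qed.

Lemma smoothV f : (forall x, U x -> f x != 0) -> smooth U f ->
  smooth U (fun x => (f x)^-1).
Proof. by move=> f0 sf k; exact: CkV. Qed.

Lemma partialD i f g x : smooth U f -> smooth U g -> U x ->
  partial i (f + g) x = partial i f x + partial i g x.
Proof.
move=> sf sg Ux; rewrite /partial deriveD //.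
- exact: Ck_derivable (sf 1%N) x Ux.
- exact: Ck_derivable (sg 1%N) x Ux.
Qed.

Lemma partialM i f g x : smooth U f -> smooth U g -> U x ->
  partial i (f * g) x = partial i f x * g x + f x * partial i g x.
Proof.
move=> sf sg Ux; rewrite /partial deriveM; last 2 first.
- exact: Ck_derivable (sf 1%N) x Ux.
- exact: Ck_derivable (sg 1%N) x Ux.
by rewrite addrC [X in X + _]mulrC.
Qed.

Lemma partialC i j f x : smooth U f -> U x ->
  partial i (partial j f) x = partial j (partial i f) x.
Proof.
move=> sf Ux; apply: (derive_comm U_open Ux) => [y Uy|y Uy||].
- by split; exact: Ck_derivable (sf 1%N) y Uy.
- split.
    exact: Ck_derivable (smooth_partial j sf 1%N) y Uy.
  exact: Ck_derivable (smooth_partial i sf 1%N) y Uy.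
- exact: Ck_continuous (smooth_partial i (smooth_partial j sf) 0%N) x Ux.
- exact: Ck_continuous (smooth_partial j (smooth_partial i sf) 0%N) x Ux.
Qed.

Lemma smooth_sum (I : Type) (r : seq I) (P : pred I) (F : I -> 'rV[R]_n -> R) :
  (forall i, smooth U (F i)) -> smooth U (fun x => \sum_(i <- r | P i) F i x).
Proof.
move=> sF; elim: r => [|i r IH].
  by apply: eq_smooth (smooth_cst 0) => x _; rewrite big_nil.
case Pi: (P i); last by apply: eq_smooth IH => x _; rewrite big_cons Pi.
by apply: eq_smooth (smoothD (sF i) IH) => x _; rewrite big_cons Pi fctE.
Qed.

Lemma smooth_prod (I : Type) (r : seq I) (P : pred I) (F : I -> 'rV[R]_n -> R) :
  (forall i, smooth U (F i)) -> smooth U (fun x => \prod_(i <- r | P i) F i x).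
Proof.
move=> sF; elim: r => [|i r IH].
  by apply: eq_smooth (smooth_cst 1) => x _; rewrite big_nil.
case Pi: (P i); last by apply: eq_smooth IH => x _; rewrite big_cons Pi.
by apply: eq_smooth (smoothM (sF i) IH) => x _; rewrite big_cons Pi fctE.
Qed.

Lemma smooth_det m (M : 'rV[R]_n -> 'M[R]_m) :
  (forall i j, smooth U (fun x => M x i j)) -> smooth U (fun x => \det (M x)).
Proof.
move=> sM; apply: smooth_sum => s.
by apply: (smoothM (smooth_cst _)); apply: smooth_prod => i; exact: sM.
Qed.

(** Cramer's rule: the entries are cofactors divided by a determinant that does not vanish on
    [U]. *)
Lemma smooth_invmx m (M : 'rV[R]_n -> 'M[R]_m) :
  (forall i j, smooth U (fun x => M x i j)) ->
  (forall x, U x -> M x \in unitmx) ->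
  forall i j, smooth U (fun x => invmx (M x) i j).
Proof.
move=> sM uM i j.
have sadj : smooth U (fun x => (\adj (M x)) i j).
  apply: eq_smooth (smoothM (smooth_cst ((-1) ^+ (j + i)))
    (smooth_det (M := fun x => row' j (col' i (M x))) _)) => [x _|a b].
    by rewrite mxE.
  by apply: eq_smooth (sM (lift j a) (lift i b)) => x _; rewrite !mxE.
have sdet : smooth U (fun x => (\det (M x))^-1).
  apply: smoothV (smooth_det sM) => x Ux.
  by rewrite -unitfE -unitmxE; exact: uM.
apply: eq_smooth (smoothM sdet sadj) => x Ux.
by rewrite /invmx uM // mxE.
Qed.

End SmoothClosure.

(** * The ring of smooth functions *)

Section SmoothRing.
Variables (R : realType) (n : nat) (U : set 'rV[R]_n) (U_open : open U).

(* Two smooth functions that agree on U are equal as elements of this type,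
   because its elements vanish outside U. *)
Record smooth_fun (U_open : open U) := SmoothFun {
  sf_val :> 'rV[R]_n -> R;
  sf_smooth : smooth U sf_val;
  sf_out : forall x, ~ U x -> sf_val x = 0
}.

Local Notation A := (smooth_fun U_open).

Lemma sf_ext (f g : A) : (forall x, U x -> f x = g x) -> f = g.
Proof.
case: f g => [f sf f0] [g sg g0] /= fg.
have E : f = g.
  apply: funext => x; have [Ux|nUx] := pselect (U x); first exact: fg.
  by rewrite f0 // g0.
rewrite -{g}E in sg g0 fg *; congr SmoothFun; exact: Prop_irrelevance.
Qed.

(** Selects the representative that vanishes off [U], which makes agreement on [U] an equality in
    the ring. *)
Definition cut (F : 'rV[R]_n -> R) x : R := if pselect (U x) then F x else 0.

Lemma cut_in F x : U x -> cut F x = F x.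
Proof. by rewrite /cut; case: pselect. Qed.

Lemma cut_out F x : ~ U x -> cut F x = 0.
Proof. by rewrite /cut; case: pselect. Qed.

Lemma smooth_cut F : smooth U F -> smooth U (cut F).
Proof. by apply: eq_smooth => // x Ux; rewrite cut_in. Qed.

Definition mk_smooth F (sF : smooth U F) : A :=
  SmoothFun U_open (smooth_cut sF) (@cut_out F).

Lemma mk_smoothE F (sF : smooth U F) x : U x -> mk_smooth sF x = F x.
Proof. exact: cut_in. Qed.

Definition sf_cst (c : R) : A := mk_smooth (smooth_cst U_open c).
Definition sf_add (f g : A) : A :=
  mk_smooth (smoothD U_open (sf_smooth f) (sf_smooth g)).
Definition sf_mul (f g : A) : A :=
  mk_smooth (smoothM U_open (sf_smooth f) (sf_smooth g)).
Definition sf_opp (f : A) : A := sf_mul (sf_cst (-1)) f.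
Definition sf_der i (f : A) : A := mk_smooth (smooth_partial i (sf_smooth f)).

Lemma sf_cstE c x : U x -> sf_cst c x = c.
Proof. exact: cut_in. Qed.
Lemma sf_addE (f g : A) x : U x -> sf_add f g x = f x + g x.
Proof. exact: cut_in. Qed.
Lemma sf_mulE (f g : A) x : U x -> sf_mul f g x = f x * g x.
Proof. exact: cut_in. Qed.
Lemma sf_oppE (f : A) x : U x -> sf_opp f x = - f x.
Proof. by move=> Ux; rewrite sf_mulE // sf_cstE // mulN1r. Qed.

Definition sfE := (sf_cstE, sf_addE, sf_mulE, sf_oppE).

HB.instance Definition _ := gen_eqMixin A.
HB.instance Definition _ := gen_choiceMixin A.

Fact sf_addA : associative sf_add.
Proof. by move=> f g h; apply: sf_ext => x Ux; rewrite !sfE // addrA. Qed.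
Fact sf_addC : commutative sf_add.
Proof. by move=> f g; apply: sf_ext => x Ux; rewrite !sfE // addrC. Qed.
Fact sf_add0 : left_id (sf_cst 0) sf_add.
Proof. by move=> f; apply: sf_ext => x Ux; rewrite !sfE // add0r. Qed.
Fact sf_addN : left_inverse (sf_cst 0) sf_opp sf_add.
Proof. by move=> f; apply: sf_ext => x Ux; rewrite !sfE // addNr. Qed.

HB.instance Definition _ :=
  GRing.isZmodule.Build A sf_addA sf_addC sf_add0 sf_addN.

Fact sf_mulA : associative sf_mul.
Proof. by move=> f g h; apply: sf_ext => x Ux; rewrite !sfE // mulrA. Qed.
Fact sf_mulC : commutative sf_mul.
Proof. by move=> f g; apply: sf_ext => x Ux; rewrite !sfE // mulrC. Qed.
Fact sf_mul1 : left_id (sf_cst 1) sf_mul.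
Proof. by move=> f; apply: sf_ext => x Ux; rewrite !sfE // mul1r. Qed.
Fact sf_mulD : left_distributive sf_mul sf_add.
Proof. by move=> f g h; apply: sf_ext => x Ux; rewrite !sfE // mulrDl. Qed.

HB.instance Definition _ :=
  GRing.Zmodule_isComPzRing.Build A sf_mulA sf_mulC sf_mul1 sf_mulD.

Lemma sf_evD (f g : A) x : U x -> (f + g) x = f x + g x.
Proof. exact: sf_addE. Qed.
Lemma sf_evM (f g : A) x : U x -> (f * g) x = f x * g x.
Proof. exact: sf_mulE. Qed.
Lemma sf_evN (f : A) x : U x -> (- f) x = - f x.
Proof. exact: sf_oppE. Qed.
Lemma sf_ev0 x : U x -> (0 : A) x = 0.
Proof. exact: sf_cstE. Qed.
Lemma sf_ev1 x : U x -> (1 : A) x = 1.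
Proof. exact: sf_cstE. Qed.
Lemma sf_ev_nat m x : U x -> (m%:R : A) x = m%:R.
Proof.
move=> Ux; elim: m => [|m IH]; first exact: sf_ev0.
by rewrite !mulrS sf_evD // sf_ev1 // IH.
Qed.
Lemma sf_der_in i (f : A) x : U x -> sf_der i f x = partial i f x.
Proof. exact: cut_in. Qed.

Lemma sf_derD i : {morph sf_der i : f g / f + g}.
Proof.
move=> f g; apply: sf_ext => x Ux.
rewrite sf_evD // !sf_der_in // -(partialD i (sf_smooth f) (sf_smooth g) Ux).
by apply: (partial_eq U_open) => // y Uy; rewrite sf_evD.
Qed.

Lemma sf_derM i (f g : A) : sf_der i (f * g) = sf_der i f * g + f * sf_der i g.
Proof.
apply: sf_ext => x Ux.
rewrite sf_evD // !sf_evM // !sf_der_in // -(partialM i (sf_smooth f) (sf_smooth g) Ux).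
by apply: (partial_eq U_open) => // y Uy; rewrite sf_evM.
Qed.

Lemma sf_der2_in i j (f : A) x : U x ->
  sf_der i (sf_der j f) x = partial i (partial j f) x.
Proof.
move=> Ux; apply: (etrans (sf_der_in i (sf_der j f) Ux)).
by apply: (partial_eq U_open i _ Ux) => y; exact: sf_der_in.
Qed.

Lemma sf_derC i j (f : A) : sf_der i (sf_der j f) = sf_der j (sf_der i f).
Proof.
apply: sf_ext => x Ux; apply: (etrans (sf_der2_in i j f Ux)).
apply: (etrans (partialC U_open i j (sf_smooth f) Ux)).
exact: esym (sf_der2_in j i f Ux).
Qed.

Lemma partial_sf i F (f : A) : (forall y, U y -> F y = f y) ->
  forall x, U x -> partial i F x = sf_der i f x.
Proof.
by move=> Ff x Ux; rewrite sf_der_in //; apply: (partial_eq U_open).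
Qed.

End SmoothRing.

(** * From the ring to functions on a chart *)

(* [A] is to be [smooth_fun], kept abstract so that unification cannot unfold
   the ring operations and [partial]. *)
Section Transfer.
Variables (R : realType) (n : nat) (U : set 'rV[R]_n) (U_open : open U).
Variables (A : comPzRingType) (ev : 'rV[R]_n -> A -> R) (d : 'I_n -> A -> A).
Hypothesis ev_ext : forall f g, (forall x, U x -> ev x f = ev x g) -> f = g.
Hypothesis evD : forall x f g, U x -> ev x (f + g) = ev x f + ev x g.
Hypothesis evM : forall x f g, U x -> ev x (f * g) = ev x f * ev x g.
Hypothesis evN : forall x f, U x -> ev x (- f) = - ev x f.
Hypothesis ev_nat : forall x m, U x -> ev x m%:R = m%:R.
Hypothesis ev_lift : forall F, smooth U F ->
  exists f, forall x, U x -> ev x f = F x.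
Hypothesis ev_d : forall i F f, (forall y, U y -> F y = ev y f) ->
  forall x, U x -> partial i F x = ev x (d i f).
Hypothesis dD : forall i, {morph d i : f g / f + g}.
Hypothesis dM : forall i f g, d i (f * g) = d i f * g + f * d i g.
Hypothesis dC : forall i j f, d i (d j f) = d j (d i f).

Lemma ev0 x : U x -> ev x 0 = 0.
Proof. exact: ev_nat 0%N. Qed.

Lemma evB x f g : U x -> ev x (f - g) = ev x f - ev x g.
Proof. by move=> Ux; rewrite evD // evN. Qed.

Lemma ev_sum x (I : finType) (F : I -> A) : U x ->
  ev x (\sum_i F i) = \sum_i ev x (F i).
Proof.
by move=> Ux; apply: (big_morph (ev x)) => [f g|]; [exact: evD | exact: ev0].
Qed.

Lemma ev_lift_mx (M : 'rV[R]_n -> 'M[R]_n) :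
  (forall a b, smooth U (fun x => M x a b)) ->
  exists aM : 'M[A]_n, forall x, U x -> forall a b, M x a b = ev x (aM a b).
Proof.
move=> sM.
have [f fE] := choice (fun ab : 'I_n * 'I_n => ev_lift (sM ab.1 ab.2)).
exists (\matrix_(a, b) f (a, b)) => x Ux a b.
by rewrite mxE (fE (a, b)).
Qed.

Variables (G : 'rV[R]_n -> 'M[R]_n) (aG aH : 'M[A]_n) (half kap : A).
Hypothesis aGE : forall x, U x -> forall a b, G x a b = ev x (aG a b).
Hypothesis aHE : forall x, U x -> forall a b, ginv G x a b = ev x (aH a b).
Hypothesis halfE : forall x, U x -> ev x half = 2^-1.
Hypothesis kapE : forall x, U x -> ev x kap = (2 * (n%:R - 1))^-1.
Hypothesis G_metric : forall x, U x -> (G x)^T = G x /\ G x \in unitmx.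

Definition aGam i : 'M[A]_n := \matrix_(k, j) (half * \sum_f aH k f *
  (d i (aG j f) + d j (aG i f) - d f (aG i j))).

Lemma aGE_fun a b y : U y -> G y a b = ev y (aG a b).
Proof. by move=> Uy; exact: aGE. Qed.

Lemma christoffelE x k i j : U x -> christoffel G x k i j = ev x (aGam i k j).
Proof.
move=> Ux; rewrite mxE evM // halfE // ev_sum // /christoffel; congr (_ * _).
apply: eq_bigr => f _; rewrite evM // aHE //; congr (_ * _).
rewrite evB // evD //.
by rewrite !(ev_d _ (@aGE_fun _ _)).
Qed.

(** Agreement of [T] with a ring matrix on [U] suffices, so derived fields such as [schouten] can be
    differentiated directly. *)
Lemma nabla2E (T : 'rV[R]_n -> 'M[R]_n) (aT : 'M[A]_n) :
  (forall y, U y -> forall a b, T y a b = ev y (aT a b)) ->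
  forall x, U x -> forall c a b, nabla2 G T x c a b = ev x (cov d aGam c aT a b).
Proof.
move=> TE x Ux c a b; rewrite covE /nabla2 evB // evB // !ev_sum //.
have TE' y : U y -> T y a b = ev y (aT a b) by move=> Uy; exact: TE.
rewrite (ev_d c TE' Ux); congr (_ - _ - _); apply: eq_bigr => f _.
  by rewrite evM // christoffelE // TE.
by rewrite evM // christoffelE // TE // mulrC.
Qed.

Lemma riemannE x c f a b : U x ->
  riemann G x c f a b = ev x (curv d aGam a b c f).
Proof.
move=> Ux; have CE k i j y : U y -> christoffel G y k i j = ev y (aGam i k j).
  by move=> Uy; exact: christoffelE.
have -> : curv d aGam a b c f = d a (aGam b c f) - d b (aGam a c f)
    + \sum_e aGam a c e * aGam b e f - \sum_e aGam b c e * aGam a e f.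
  rewrite /curv mxsubE mxaddE mxsubE.
  by congr (_ - _ + _ - _); rewrite mxE.
rewrite /riemann (ev_d a (CE c b f) Ux) (ev_d b (CE c a f) Ux).
rewrite evB // evD // evB // !ev_sum // -[in RHS]addrA -sumrB; congr (_ + _).
by apply: eq_bigr => e _; rewrite !evM // !CE.
Qed.

Lemma ricciE x a b : U x -> ricci G x a b = ev x (ric d aGam a b).
Proof.
move=> Ux; rewrite !mxE ev_sum //.
by apply: eq_bigr => c _; rewrite riemannE.
Qed.

Lemma ev_pairing x (X F : 'M[A]_n) : U x ->
  ev x (pairing X F) = \sum_a \sum_b ev x (X a b) * ev x (F a b).
Proof.
move=> Ux; rewrite /pairing ev_sum //; apply: eq_bigr => a _.
by rewrite ev_sum //; apply: eq_bigr => b _; rewrite evM.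
Qed.

Lemma scalE x : U x -> scalar_curvature G x = ev x (scal d aGam aH).
Proof.
move=> Ux; rewrite ev_pairing //; apply: eq_bigr => a _.
by apply: eq_bigr => b _; rewrite aHE // ricciE.
Qed.

Lemma schoutenE x : U x ->
  forall a b, schouten G x a b = ev x (sch d aGam aG aH kap a b).
Proof.
move=> Ux a b; rewrite /schouten /sch mxsubE mxsubE mxscaleE mxscaleE.
by rewrite evB // !evM // ricciE // scalE // kapE // aGE.
Qed.

Lemma cottonE x a b c : U x ->
  cotton G x b c a = ev x (cot d aGam aG aH kap a b c).
Proof.
move=> Ux; rewrite /cotton mxfunE evB //.
by rewrite !(nabla2E schoutenE).
Qed.

Lemma raise2E (T : 'rV[R]_n -> 'M[R]_n) (aT : 'M[A]_n) :
  (forall y, U y -> forall a b, T y a b = ev y (aT a b)) ->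
  forall x, U x -> forall a b, raise2 G T x a b = ev x (raised aH aT a b).
Proof.
move=> TE x Ux a b; rewrite /raise2 /raised !mxE ev_sum //.
apply: eq_bigr => c _; rewrite evM // !mxE ev_sum // aHE //; congr (_ * _).
by apply: eq_bigr => f _; rewrite evM // aHE // TE.
Qed.

Lemma currentE (T : 'rV[R]_n -> 'M[R]_n) (aT : 'M[A]_n) :
  (forall y, U y -> forall a b, T y a b = ev y (aT a b)) ->
  forall a x, U x -> cky_cotton_current G T x 0 a =
    ev x (current d aGam aG aH kap aT a).
Proof.
move=> TE a x Ux; rewrite mxE ev_pairing //; apply: eq_bigr => b _.
by apply: eq_bigr => c _; rewrite cottonE // (raise2E TE) // mulrC.
Qed.

Lemma divergenceE (T : 'rV[R]_n -> 'M[R]_n) (aT : 'M[A]_n) :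
  (forall y, U y -> forall a b, T y a b = ev y (aT a b)) ->
  forall x, U x -> divergence G (cky_cotton_current G T) x =
    ev x (div_current d aGam aG aH kap aT).
Proof.
move=> TE x Ux; rewrite /divergence /div_current ev_sum //.
apply: eq_bigr => a _; rewrite ev_sum //; apply: eq_bigr => b _.
rewrite evM // aHE //; congr (_ * _); rewrite evB // ev_sum // /nabla1.
rewrite (ev_d b (fun y Uy => currentE TE a Uy) Ux); congr (_ - _).
by apply: eq_bigr => f _; rewrite evM // christoffelE // (currentE TE).
Qed.

(** * Conservation in a single chart *)

Variables (T : 'rV[R]_n -> 'M[R]_n) (aT : 'M[A]_n).
Hypothesis TE : forall y, U y -> forall a b, T y a b = ev y (aT a b).
Hypothesis T_asym : forall x, U x -> (T x)^T = - T x.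
Variable (z : 'rV[R]_n -> 'I_n -> 'I_n -> 'I_n -> R).
Hypothesis z_smooth : forall a b c, smooth U (fun x => z x a b c).
Hypothesis z_asym : forall x, U x -> forall a b c,
  z x b a c = - z x a b c /\ z x a c b = - z x a b c.
Hypothesis cky : forall x, U x -> forall a b c,
  nabla2 G T x c a b =
    G x c a * cky_xi G T x b - G x c b * cky_xi G T x a + z x a b c.
Hypothesis n_gt1 : (1 < n)%N.

Lemma natr_sub1_neq0 : n%:R - 1 != 0 :> R.
Proof. by rewrite subr_eq0 -[1]/(1%:R) eqr_nat; case: (n) n_gt1 => [|[]]. Qed.

(** [kap + kap] is 1/(n-1), the factor in the definition of xi. *)
Lemma cky_xiE x a : U x -> cky_xi G T x a =
  ev x ((kap + kap) * pairing aH (\matrix_(b, c) cov d aGam c aT b a)).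
Proof.
move=> Ux; rewrite evM // evD // kapE // ev_pairing //; congr (_ * _).
  by have := natr_sub1_neq0 => m0; field.
apply: eq_bigr => b _; apply: eq_bigr => c _.
by rewrite mxfunE aHE // (nabla2E TE).
Qed.

(** The geometric hypotheses of [div_current_eq0] are ring equalities; [ev_ext] reduces them to
    pointwise statements on [U], where the facts about the metric, the connection and the CKY
    equation apply. *)
Theorem divergence_eq0 x : U x -> divergence G (cky_cotton_current G T) x = 0.
Proof.
move=> Ux; rewrite (divergenceE TE Ux) -[RHS](ev0 Ux); congr (ev x _).
have [z' z'E] := choice (fun abc : 'I_n * 'I_n * 'I_n =>
  ev_lift (z_smooth abc.1.1 abc.1.2 abc.2)).
have Go y : U y -> (G y)^T = G y by move=> Uy; exact: (G_metric Uy).1.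
have GTE y : U y -> forall a b, G y a b = G y b a.
  by move=> Uy a b; rewrite -[in LHS](Go y Uy) mxE.
apply: (@div_current_eq0 A n d dD dM dC aGam _ aG aH half _ _ _ _ kap _ _ aT _
  (fun a => (kap + kap) * pairing aH (\matrix_(b, c) cov d aGam c aT b a))
  (fun a b c => z' (a, b, c))).
- move=> i j k; apply: ev_ext => y Uy.
  by rewrite -!christoffelE //; exact: christoffel_torsion_free U_open Go _ Uy _ _ _.
- apply: ev_ext => y Uy; rewrite evD // halfE // (ev_nat 1%N Uy).
  by field.
- apply/matrixP => a b; rewrite mxE; apply: ev_ext => y Uy.
  by rewrite -!aGE //; exact: GTE.
- apply/matrixP => a b; apply: ev_ext => y Uy; rewrite [in LHS]mxE ev_sum // mxE.
  transitivity ((ginv G y *m G y) a b).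
    by rewrite mxE; apply: eq_bigr => c _; rewrite evM // aHE // aGE.
  by rewrite mulVmx ?(G_metric Uy).2 // mxE ev_nat.
- move=> i; apply/matrixP => a b; apply: ev_ext => y Uy.
  rewrite -(nabla2E aGE Uy) mxzeroE ev0 //.
  exact: nabla2_metric U_open G_metric _ Uy _ _ _.
- apply: ev_ext => y Uy; rewrite evM // kapE // !ev_nat // natrM.
  have -> : n.-1%:R = n%:R - 1 :> R.
    by rewrite -[in RHS](prednK (ltnW n_gt1)) -natr1 addrK.
  by rewrite (ev_nat 1%N Uy) mulVf // mulf_neq0 ?pnatr_eq0 // natr_sub1_neq0.
- exact: ltnW.
- apply/matrixP => a b; rewrite mxtrE mxoppE; apply: ev_ext => y Uy.
  rewrite evN // -!TE //.
  have := congr1 (fun M : 'M[R]_n => M a b) (T_asym Uy).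
  by rewrite mxtrE mxoppE.
- move=> p q e; apply: ev_ext => y Uy; rewrite evN // !z'E //=.
  exact: (z_asym Uy p q e).1.
- move=> p q e; apply: ev_ext => y Uy; rewrite evN // !z'E //=.
  exact: (z_asym Uy p q e).2.
move=> e p q; apply: ev_ext => y Uy.
by rewrite -(nabla2E TE Uy) cky // !cky_xiE // !aGE // evD // evB // !evM // z'E.
Qed.

End Transfer.

Unset Implicit Arguments.

Theorem mainTheorem1 (R : realType) (n : nat) (n_ge3 : (3 <= n)%N)
    (M : manifold R n) (g : field2 M) (g_metric : is_metric g)
    (Y : field2 M) (Y_CKY : is_CKY g Y) :
  forall e : chart R n M, atlas e -> forall x : 'rV[R]_n, cimage e x ->
    divergence (g e) (cky_cotton_current (g e) (Y e)) x = 0.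
Proof.
move=> e Ae x Ux.
have [[g_smooth _] /(_ e Ae) g_sym] := g_metric.
have [[[Y_smooth _] /(_ e Ae) Y_asym] [z z_form /(_ e Ae) cky]] := Y_CKY.
have [[z_smooth _] /(_ e Ae) z_asym] := z_form.
have U_open : open (cimage e) by exact: cimage_open.
pose A : comPzRingType := smooth_fun U_open.
pose ev (y : 'rV[R]_n) (f : A) : R := (f : smooth_fun U_open) y.
have lift F : smooth (cimage e) F ->
    exists f : A, forall y, cimage e y -> ev y f = F y.
  by move=> sF; exists (mk_smooth U_open sF) => y Uy; exact: mk_smoothE.
have [aG aGE] := ev_lift_mx lift (g_smooth e Ae).
(* The inverse metric is lifted as a smooth matrix in its own right; that it inverts the lifted
   metric is checked pointwise in [divergence_eq0]. *)
have [aH aHE] := ev_lift_mx lift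
  (smooth_invmx U_open (g_smooth e Ae) (fun y Uy => (g_sym y Uy).2)).
have [aY aYE] := ev_lift_mx lift (Y_smooth e Ae).
have [half halfE] := lift _ (smooth_cst U_open 2^-1).
have [kap kapE] := lift _ (smooth_cst U_open (2 * (n%:R - 1))^-1).
apply: (@divergence_eq0 R n (cimage e) U_open A ev (@sf_der R n _ U_open)
  _ _ _ _ _ lift _ _ _ _ (g e) aG aH half kap aGE aHE halfE kapE g_sym
  (Y e) aY aYE Y_asym (z e) (z_smooth e Ae) z_asym cky (ltnW n_ge3) x Ux).
- exact: sf_ext.
- move=> y f h Uy; exact: sf_evD.
- move=> y f h Uy; exact: sf_evM.
- move=> y f Uy; exact: sf_evN.
- move=> y m Uy; exact: sf_ev_nat.
- move=> i F f Ff y Uy; exact: partial_sf.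
- exact: sf_derD.
- exact: sf_derM.
- exact: sf_derC.
Qed.
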